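(* Let $1<p<\infty$ and let $\beta<p-1$ be real. Then there exist $q=q(\beta,p)$ with $1<q<p$ and a constant $C>0$, both independent of the domain $\Omega$ below, such that for every simply connected domain $\Omega\subsetneq\mathbb{C}$, every $u\in C_0^\infty(\Omega)$ and every $x\in\Omega$, $$|u(x)|\leq C\, d_{\Omega}(x)^{1-\frac{\beta}{p}}\sup_{0<r<2d_{\Omega}(x)}\left(\frac{1}{|B(x,r)\cap\Omega|}\int_{B(x,r)\cap\Omega}|\nabla u(y)|^q\, d_{\Omega}(y)^{q\beta/p}\,dy\right)^{1/q}.$$
   Context: $d_\Omega(x):=\mathrm{dist}(x,\partial\Omega)$ is the Euclidean distance to the boundary of $\Omega$, $B(x,r)$ is the Euclidean disk with center $x$ and radius $r$, $|\cdot|$ of a set denotes two-dimensional Lebesgue measure, and $C_0^\infty(\Omega)$ is the space of smooth functions with compact support in $\Omega$. *)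

(* Defs.v *)
From HB Require Import structures.
From mathcomp Require Import all_boot all_order all_algebra.
From mathcomp Require Import all_classical all_reals all_analysis.
Import Order.TTheory GRing.Theory Num.Theory.
Import numFieldNormedType.Exports.

Set Implicit Arguments.
Unset Strict Implicit.
Unset Printing Implicit Defensive.

Local Open Scope classical_set_scope.
Local Open Scope ring_scope.

(** The complex plane is identified with [R * R].  The library's norm on a
    product is the sup norm; it induces the usual topology, but Euclidean
    distances have to be introduced separately. *)

Section Plane.
Variable R : realType.
Implicit Types (x y : R * R) (A Omega : set (R * R)).

Definition eucl_norm x : R := Num.sqrt (x.1 ^+ 2 + x.2 ^+ 2).

Definition eucl_dist_set x A : R := inf [set eucl_norm (x - y) | y in A].

Definition eucl_disk x (r : R) : set (R * R) :=
  [set y | eucl_norm (y - x) < r].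

Definition boundary A : set (R * R) := closure A `\` interior A.

Definition dist_boundary Omega x : R := eucl_dist_set x (boundary Omega).

(** Domains, and simple connectedness: every loop is contractible inside
    [Omega] by a homotopy fixing its base point.  Paths and homotopies are
    total functions of which only the restriction to [0, 1], resp. [0, 1]^2,
    is relevant. *)

Definition domain Omega : Prop :=
  [/\ open Omega, connected Omega & Omega !=set0].

Definition is_loop Omega (g : R -> R * R) : Prop :=
  [/\ {within `[0, 1]%classic, continuous g},
      (forall t : R, t \in `[0, 1] -> Omega (g t)) & g 0 = g 1].

Definition null_homotopic Omega (g : R -> R * R) : Prop :=
  exists H : R * R -> R * R,
    [/\ {within `[0, 1]%classic `*` `[0, 1]%classic, continuous H},
        (forall t s : R, t \in `[0, 1] -> s \in `[0, 1] -> Omega (H (t, s))),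
        (forall t : R, t \in `[0, 1] -> H (t, 0) = g t),
        (forall t : R, t \in `[0, 1] -> H (t, 1) = g 0) &
        (forall s : R, s \in `[0, 1] -> H (0, s) = g 0 /\ H (1, s) = g 0)].

Definition simply_connected_domain Omega : Prop :=
  domain Omega /\ forall g, is_loop Omega g -> null_homotopic Omega g.

(** [partial false] and [partial true] are the partial derivatives with
    respect to the first and second coordinates. *)

Definition basis_vec (b : bool) : R * R := if b then (0, 1) else (1, 0).

Definition partial (b : bool) (u : R * R -> R) : R * R -> R :=
  fun x => 'D_(basis_vec b) u x.

Definition iter_partial (s : seq bool) (u : R * R -> R) : R * R -> R :=
  foldr partial u s.

Definition smooth (u : R * R -> R) : Prop :=
  forall s : seq bool,
    continuous (iter_partial s u) /\
    forall b x, derivable (iter_partial s u) x (basis_vec b).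

(** Elements of [C_0^oo(Omega)] are identified with their extensions by zero
    to the plane. *)
Definition test_function Omega (u : R * R -> R) : Prop :=
  let supp := closure [set x | u x != 0] in
  [/\ smooth u, compact supp & supp `<=` Omega].

Definition grad (u : R * R -> R) : R * R -> R * R :=
  fun x => (partial false u x, partial true u x).

Definition lebesgue2 :
    {measure set (measurableTypeR R * measurableTypeR R) -> \bar R} :=
  (@lebesgue_measure R \x @lebesgue_measure R)%E.

Definition average A (f : R * R -> \bar R) : \bar R :=
  ((lebesgue2 A)^-1 * \int[lebesgue2]_(y in A) f y)%E.

End Plane.

(* Main.v *)
Require Import Defs.
From mathcomp Require Import all_boot all_order all_algebra.
From mathcomp Require Import all_classical all_reals all_analysis.
From mathcomp Require Import measurable_realfun ring lra.
Import Order.TTheory GRing.Theory Num.Theory.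
Import numFieldNormedType.Exports.

Set Implicit Arguments.
Unset Strict Implicit.
Unset Printing Implicit Defensive.

Local Open Scope classical_set_scope.
Local Open Scope ring_scope.

(** Let [d] be the distance to the boundary.  Choose [q] so close to [p] that
    [gamma = q * beta / p] satisfies [gamma < q - 1], and call energy of a set
    the integral over it of [|grad u|^q * d^gamma].  The proof descends from
    [x] to the boundary, where [u] vanishes, along a path on which the energy
    decreases fast enough for the increments of [u] to be summable.

    One step of the descent starts from a point [v] with [rho = d v] and
    follows small steps inside the set where [d] is at least [delta * rho],
    without going further than [5/4 * rho] away from [v].  Simple connectedness
    enters here, and only here: a circle around [v] of radius larger than [rho]
    surrounds a point outside of [Omega], so that it cannot lie in [Omega]
    ([circle_meets_complement]).  Therefore what can be reached from [v] ends,
    on [N] well separated circles or lines, [N] being of order [1 / delta], at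
    points where [d] is exactly [delta * rho] ([separated_exit_points]).  The
    disks of radius [3/2 * d] around these exit points are disjoint and lie in
    the disk of radius [3/2 * rho] around [v], so that one of them carries at
    most [1 / N] of its energy; this is where the descent continues
    ([descent_step]).

    On the way [u] varies by at most a constant, depending on [delta], times
    [rho^(1 - (gamma + 2) / q) * E^(1/q)], where [E] is the energy of the disk
    around [v].  From one step to the next, this bound is multiplied by
    [delta^(1 - (gamma + 2) / q) * N^(-1/q)], which is a constant times
    [(delta^(q - 1 - gamma))^(1/q)], hence is less than [1] when [delta] is
    small ([descent_ratio_lt1]).  The increments thus form a geometric series,
    and the first term controls the sum ([descent_bound]).

    Before the descent, the value of [u] at [x] is compared with a value at
    scale [d x] by telescoping over dyadic squares centered at [x], where the
    weight is comparable to a constant ([start_bound]).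

    All local comparisons use good points instead of mean values of [u]: by
    Tonelli's theorem, in the middle of each square some point is such that the
    horizontal and the vertical line through it carry at most their share of
    the integrals of the partial derivatives.  The good points of two squares
    of comparable sizes and positions are joined by a horizontal and a vertical
    segment ([good_point_variation]). *)

(** * Euclidean geometry of the plane *)

Section EuclideanNorm.
Context {R : realType}.
Implicit Types (x y z : R * R) (A : set (R * R)).

Lemma eucl_norm_ge0 x : 0 <= eucl_norm x.
Proof. exact: sqrtr_ge0. Qed.

Lemma eucl_normN x : eucl_norm (- x) = eucl_norm x.
Proof. by rewrite /eucl_norm /= !sqrrN. Qed.

Lemma eucl_distC x y : eucl_norm (x - y) = eucl_norm (y - x).
Proof. by rewrite -eucl_normN opprB. Qed.

Lemma sqr_eucl_norm x : eucl_norm x ^+ 2 = x.1 ^+ 2 + x.2 ^+ 2.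
Proof. by rewrite /eucl_norm sqr_sqrtr// addr_ge0 ?sqr_ge0. Qed.

Lemma eucl_norm_le x (r : R) : 0 <= r ->
  (eucl_norm x <= r) = (x.1 ^+ 2 + x.2 ^+ 2 <= r ^+ 2).
Proof.
by move=> r0; rewrite -sqr_eucl_norm ler_pXn2r// nnegrE ?eucl_norm_ge0.
Qed.

Lemma ler_eucl_normD x y : eucl_norm (x + y) <= eucl_norm x + eucl_norm y.
Proof.
have [x0 y0] := (eucl_norm_ge0 x, eucl_norm_ge0 y).
rewrite eucl_norm_le ?addr_ge0//= [leRHS]sqrrD !sqr_eucl_norm.
suff : x.1 * y.1 + x.2 * y.2 <= eucl_norm x * eucl_norm y by nra.
have [le0|/ltW ge0] := leP (x.1 * y.1 + x.2 * y.2) 0.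
  by rewrite (le_trans le0)// mulr_ge0.
rewrite -(@ler_pXn2r _ 2)// ?nnegrE ?mulr_ge0// exprMn !sqr_eucl_norm.
by have := sqr_ge0 (x.1 * y.2 - x.2 * y.1); nra.
Qed.

Lemma ler_eucl_distD y x z :
  eucl_norm (x - z) <= eucl_norm (x - y) + eucl_norm (y - z).
Proof. by rewrite (le_trans _ (ler_eucl_normD _ _))// addrA subrK. Qed.

Lemma ler_fst_eucl_norm x : `|x.1| <= eucl_norm x.
Proof.
rewrite -(@ler_pXn2r _ 2)// ?nnegrE ?eucl_norm_ge0//.
by rewrite real_normK ?num_real// sqr_eucl_norm lerDl sqr_ge0.
Qed.

Lemma ler_snd_eucl_norm x : `|x.2| <= eucl_norm x.
Proof.
rewrite -(@ler_pXn2r _ 2)// ?nnegrE ?eucl_norm_ge0//.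
by rewrite real_normK ?num_real// sqr_eucl_norm lerDr sqr_ge0.
Qed.

Lemma eucl_norm_le_sum x : eucl_norm x <= `|x.1| + `|x.2|.
Proof.
rewrite eucl_norm_le ?addr_ge0// sqrrD !real_normK ?num_real//.
by have := mulr_ge0 (normr_ge0 x.1) (normr_ge0 x.2); lra.
Qed.

Lemma eucl_normZ (t : R) x : eucl_norm (t *: x) = `|t| * eucl_norm x.
Proof.
by rewrite /eucl_norm /= !exprMn -mulrDr sqrtrM ?sqr_ge0// sqrtr_sqr.
Qed.

Lemma eucl_norm0 : eucl_norm (0 : R * R) = 0.
Proof. by rewrite /eucl_norm /= expr0n addr0 sqrtr0. Qed.

(** The topology of the plane is that of the sup norm; this is the bridge to
    Euclidean disks. *)
Lemma nearE_eucl x (P : set (R * R)) :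
  nbhs x P <-> exists2 e : R, 0 < e & forall y, eucl_norm (y - x) < e -> P y.
Proof.
split.
  move=> /nbhs_ballP[e /= e0 xP]; exists e => // y yx; apply: xP.
  split; rewrite /ball /= distrC.
    exact: le_lt_trans (ler_fst_eucl_norm (y - x)) yx.
  exact: le_lt_trans (ler_snd_eucl_norm (y - x)) yx.
move=> [e e0 xP]; apply/nbhs_ballP; exists (e / 2) => /=; first lra.
move=> y [/= xy1 xy2]; apply: xP.
rewrite eucl_distC (le_lt_trans (eucl_norm_le_sum _))//=.
move: xy1 xy2; rewrite /ball /=; lra.
Qed.

Lemma continuous_eucl_norm : continuous (@eucl_norm R).
Proof.
move=> x; apply/cvgrPdist_lt => e e0; apply/nearE_eucl; exists e => //= y yx.
have := ler_eucl_distD y x 0; have := ler_eucl_distD x y 0.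
by rewrite !subr0 (eucl_distC x y) ltr_norml; lra.
Qed.

Lemma open_eucl_disk x (r : R) : open (eucl_disk x r).
Proof.
rewrite openE => y yx; rewrite /eucl_disk /= in yx.
apply/nearE_eucl; exists (r - eucl_norm (y - x)); first lra.
by move=> z zy; have := ler_eucl_distD y z x; rewrite /eucl_disk /=; lra.
Qed.

End EuclideanNorm.

(** * Distance to the boundary *)

Section BoundaryDistance.
Context {R : realType}.
Variable Omega : set (R * R).
Hypothesis Omega_open : open Omega.
Hypothesis Omega_proper : Omega `<` [set: R * R].
Hypothesis Omega_neq0 : Omega !=set0.
Implicit Types x y z : R * R.
Local Notation d := (dist_boundary Omega).

Lemma boundaryE x : boundary Omega x <-> closure Omega x /\ ~ Omega x.
Proof. by rewrite /boundary (proj1 (interior_id _)). Qed.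

(** The last parameter, in the sense of a supremum, at which the segment from
    [y] to [z] is in [Omega] gives a boundary point. *)
Lemma boundary_on_segment y z : Omega y -> ~ Omega z ->
  exists2 b, boundary Omega b & eucl_norm (b - y) <= eucl_norm (z - y).
Proof.
move=> Oy Oz; pose g (t : R) := y + t *: (z - y).
have cg : continuous g.
  by move=> t; apply: cvgD; [exact: cvg_cst|apply: cvgZr_tmp; exact: cvg_id].
pose E := [set t : R | 0 <= t <= 1 /\ Omega (g t)].
have E0 : E 0 by split; [rewrite lexx ler01|rewrite /g scale0r addr0].
have E1 : ubound E 1 by move=> t [/andP[]].
have supE : has_sup E by split; [exists 0|exists 1].
have t01 : 0 <= sup E <= 1.
  by rewrite ub_le_sup//=; [apply: ge_sup => //; exists 0|exists 1].
exists (g (sup E)); last first.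
  rewrite /g addrC addKr eucl_normZ ler_piMl ?eucl_norm_ge0//.
  by rewrite ger0_norm; lra.
apply/boundaryE; split.
  move=> B /cg [e /= e0 eB].
  have [t [tt Ogt] tE] := sup_adherent e0 supE.
  exists (g t); split => //; apply: eB => /=.
  have /(_ t) := @ub_le_sup _ E (ex_intro _ 1 E1).
  rewrite /mkset => /(_ (conj tt Ogt)) ts.
  by rewrite ger0_norm ?subr_ge0// ltrBlDr addrC -ltrBlDr.
move=> Ogs; have /cg [e /= e0 eB] : nbhs (g (sup E)) Omega by exact: open_nbhs_nbhs.
have s1 : sup E < 1.
  rewrite lt_neqAle (andP t01).2 andbT; apply/eqP => s1.
  by apply: Oz; move: Ogs; rewrite s1 /g scale1r addrC subrK.
pose t := sup E + Num.min (e / 2) (1 - sup E).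
have m0 : 0 < Num.min (e / 2) (1 - sup E) by rewrite lt_min; apply/andP; split; lra.
have : E t.
  split.
    have : Num.min (e / 2) (1 - sup E) <= 1 - sup E by rewrite ge_min lexx orbT.
    by rewrite /t; lra.
  apply: eB => /=; rewrite /t opprD addNKr normrN gtr0_norm//.
  by rewrite gt_min; apply/orP; left; lra.
by move=> /(ub_le_sup (ex_intro _ 1 E1)); rewrite /t; lra.
Qed.

Lemma boundary_nonempty : boundary Omega !=set0.
Proof.
have [y Oy] := Omega_neq0; have [z Oz] : exists z, ~ Omega z.
  by apply/existsNP => OT; apply: Omega_proper.2 => z _; exact: contrapT (OT z).
by have [b] := boundary_on_segment Oy Oz; exists b.
Qed.

Lemma dist_boundary_ge0 x : 0 <= d x.
Proof.
have [b bB] := boundary_nonempty.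
apply: lb_le_inf; first by exists (eucl_norm (x - b)), b.
by move=> _ [y _ <-]; exact: eucl_norm_ge0.
Qed.

Lemma dist_boundary_le x y : boundary Omega y -> d x <= eucl_norm (x - y).
Proof.
move=> bB; apply: ge_inf; last by exists y.
by exists 0 => _ [z _ <-]; exact: eucl_norm_ge0.
Qed.

Lemma dist_boundary_adherent x (r : R) : d x < r ->
  exists2 y, boundary Omega y & eucl_norm (x - y) < r.
Proof.
move=> dr; have [b bB] := boundary_nonempty.
have hi : has_inf [set eucl_norm (x - y) | y in boundary Omega].
  split; first by exists (eucl_norm (x - b)), b.
  by exists 0 => _ [z _ <-]; exact: eucl_norm_ge0.
have : 0 < r - d x by lra.
move=> /(inf_adherent)/(_ hi)[_ [y By <-]].
by rewrite -/(eucl_dist_set x _) -/(dist_boundary Omega x) subrKC; exists y.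
Qed.

Lemma dist_boundary_lip x y : d x <= d y + eucl_norm (x - y).
Proof.
apply/ler_addgt0Pr => e e0.
have /dist_boundary_adherent[b bB] : d y < d y + e by lra.
have := dist_boundary_le x bB; have := ler_eucl_distD y x b; lra.
Qed.

(** Otherwise the segment from [x] to [y] would contain a boundary point too
    close to [x]. *)
Lemma near_Omega x y : Omega x -> eucl_norm (y - x) < d x -> Omega y.
Proof.
move=> Ox yx; apply: contrapT => Oy.
have [b /(dist_boundary_le x)] := boundary_on_segment Ox Oy.
by rewrite (eucl_distC x b); lra.
Qed.

Lemma dist_boundary_gt0 x : Omega x -> 0 < d x.
Proof.
move=> Ox; have /nearE_eucl[e e0 eO] : nbhs x Omega by exact: open_nbhs_nbhs.
apply: lt_le_trans e0 _; have [b bB] := boundary_nonempty.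
apply: lb_le_inf; first by exists (eucl_norm (x - b)), b.
move=> _ [y /boundaryE[_ Oy] <-]; rewrite leNgt; apply/negP.
by rewrite eucl_distC => /eO.
Qed.

Lemma continuous_dist_boundary : continuous d.
Proof.
move=> x; apply/cvgrPdist_lt => e e0; apply/nearE_eucl; exists e => //= y yx.
have := dist_boundary_lip x y; have := dist_boundary_lip y x.
by rewrite (eucl_distC x y) ltr_norml; lra.
Qed.

End BoundaryDistance.

(** * Loops in a simply connected domain do not wind around its complement *)

Section Winding.
Context {R : realType}.
Implicit Types (x y v w e : R * R) (f g : R -> R * R).

Definition rot (t : R) e : R * R :=
  (e.1 * cos t - e.2 * sin t, e.1 * sin t + e.2 * cos t).

Definition dotp x y : R := x.1 * y.1 + x.2 * y.2.

Lemma rotD s t e : rot (s + t) e = rot t (rot s e).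
Proof. by rewrite /rot /= cosD sinD; congr pair; ring. Qed.

Lemma dotp_gt0 x : x != 0 -> 0 < dotp x x.
Proof.
move=> x0; rewrite lt_neqAle addr_ge0 ?sqr_ge0// andbT; apply: contra x0.
rewrite eq_sym paddr_eq0 ?sqr_ge0// !mulf_eq0 !orbb => /andP[/eqP x1 /eqP x2].
by rewrite (surjective_pairing x) x1 x2.
Qed.

(** [Phi] is a continuous determination of the angle of [f], measured from the
    direction [e]; that it takes the same value at [0] and [1] says that the
    loop [f] has winding number zero around the origin.  Leaving [e] free
    makes constant loops trivial. *)
Definition has_closed_angle f :=
  exists (e : R * R) (Phi : R -> R), [/\ continuous Phi, Phi 0 = Phi 1 &
    forall t, exists2 r, 0 < r & f t = r *: rot (Phi t) e].

Lemma has_closed_angle_cst (c : R * R) : has_closed_angle (fun=> c).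
Proof.
exists c, (fun=> 0); split => // [t|t]; first exact: cvg_cst.
exists 1 => //; rewrite scale1r /rot cos0 sin0 !mulr1 !mulr0 subr0 add0r.
exact: surjective_pairing.
Qed.

Lemma continuous_at_pair (T : topologicalType) (a b : T -> R) (t : T) :
  {for t, continuous a} -> {for t, continuous b} ->
  {for t, continuous (fun t => (a t, b t))}.
Proof. by move=> ca cb; apply: (cvg_pair ca cb). Qed.

Lemma continuous_fst (T : topologicalType) (f : T -> R * R) :
  continuous f -> continuous (fst \o f).
Proof. by move=> cf t; apply: continuous_comp (cf t) _; exact: cvg_fst. Qed.

Lemma continuous_snd (T : topologicalType) (f : T -> R * R) :
  continuous f -> continuous (snd \o f).
Proof. by move=> cf t; apply: continuous_comp (cf t) _; exact: cvg_snd. Qed.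

(** When [f t] and [g t] make an acute angle, this angle is the arctangent of
    the ratio of their determinant to their scalar product, hence is
    continuous in [t] and can be added to the angle of [f]. *)
Lemma has_closed_angle_dotp f g : continuous f -> continuous g ->
  f 0 = f 1 -> g 0 = g 1 -> (forall t, 0 < dotp (f t) (g t)) ->
  has_closed_angle f -> has_closed_angle g.
Proof.
move=> cf cg f01 g01 fg [e [Phi [cPhi Phi01 fPhi]]].
have [cf1 cf2] := (continuous_fst cf, continuous_snd cf).
have [cg1 cg2] := (continuous_fst cg, continuous_snd cg).
pose a t := ((f t).1 * (g t).2 - (f t).2 * (g t).1) / dotp (f t) (g t).
exists e, (fun t => Phi t + atan (a t)); split.
- move=> t; apply: cvgD; first exact: cPhi.
  apply: (@continuous_comp _ _ _ a atan); last exact: continuous_atan.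
  apply: cvgM.
    by apply: cvgB; apply: cvgM; [exact: cf1|exact: cg2|exact: cf2|exact: cg1].
  apply: cvgV; first by rewrite gt_eqF.
  by apply: cvgD; apply: cvgM; [exact: cf1|exact: cg1|exact: cf2|exact: cg2].
- by rewrite Phi01 /a f01 g01.
move=> t; have [r r0 ft] := fPhi t.
have fgt := fg t.
have ff : 0 < dotp (f t) (f t).
  apply: dotp_gt0; apply/eqP => ft0.
  by move: fgt; rewrite /dotp ft0 /= !mul0r addr0 ltxx.
pose c := cos (atan (a t)).
have c0 : 0 < c.
  by rewrite /c cos_atan invr_gt0 sqrtr_gt0 ltr_pwDl// sqr_ge0.
have sE : sin (atan (a t)) = a t * c.
  by rewrite -[in RHS](atanK (a t)) /tan -/c mulfVK// gt_eqF.
exists (r * dotp (f t) (g t) / (dotp (f t) (f t) * c)).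
  by rewrite divr_gt0 ?mulr_gt0.
rewrite rotD [in RHS]/rot sE -/c.
have [f1 f2] : (f t).1 = r * (rot (Phi t) e).1 /\ (f t).2 = r * (rot (Phi t) e).2.
  by rewrite ft.
have := ff; have := fgt; rewrite /a /dotp f1 f2.
move: (rot (Phi t) e).1 (rot (Phi t) e).2 (g t) => x1 x2 [g1 g2] /= fg0 ff0.
have c_neq0 : c != 0 by rewrite gt_eqF.
have ? : (r * x1) * g1 + (r * x2) * g2 != 0 by rewrite gt_eqF.
have ? : (r * x1) * (r * x1) + (r * x2) * (r * x2) != 0 by rewrite gt_eqF.
apply/pair_equal_spec.
by split; rewrite /GRing.scale /=; field; rewrite c_neq0; apply/and3P; split.
Qed.

(** By compactness, two loops of the homotopy with close parameters make an
    acute angle at each time.  The parameters of the loops which have a closed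
    angle thus form an open and closed set, and the line is connected.  The
    function [clamp] reduces the time to a compact interval, so that [F] can be
    assumed continuous on the whole plane. *)
Lemma has_closed_angle_homotopy (F : R * R -> R * R) (clamp : R -> R) :
    continuous F ->
    (forall t, 0 <= clamp t <= 1) ->
    (forall t s, F (t, s) = F (clamp t, s)) ->
    (forall z, F z != 0) -> (forall s, F (0, s) = F (1, s)) ->
  has_closed_angle (fun t => F (t, 1)) -> has_closed_angle (fun t => F (t, 0)).
Proof.
move=> cF cl Fcl F0 Floop.
have cFs s : continuous (fun t => F (t, s)).
  move=> t; apply: (@continuous_comp _ _ _ (fun t => (t, s)) F); last exact: cF.
  apply: continuous_at_pair; [exact: cvg_id|exact: cvg_cst].
have close s : \forall s' \near s, forall t, 0 < dotp (F (t, s)) (F (t, s')).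
  have /compact_near_coveringP/(_ _ (nbhs s) (fun s' t => 0 < dotp (F (t, s)) (F (t, s')))) :=
    @segment_compact R 0 1.
  move=> near_seg.
  suff : \forall s' \near s,
      `[0, 1]%classic `<=` [set t | 0 < dotp (F (t, s)) (F (t, s'))].
    apply: filterS => s' H t; rewrite (Fcl t s) (Fcl t s').
    by apply: (H (clamp t)); rewrite /= in_itv /=.
  apply: near_seg => t _.
  pose G (z : R * R) := dotp (F (z.1, s)) (F (z.1, z.2)).
  have cG : {for (t, s), continuous G}.
    have c1 : continuous (fun z : R * R => F (z.1, s)).
      move=> z; apply: (@continuous_comp _ _ _ fst (fun t => F (t, s))); first exact: cvg_fst.
      exact: cFs.
    have c2 : continuous (fun z : R * R => F (z.1, z.2)) 
      by rewrite (_ : (fun z => _) = F)//; apply/funext => -[].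
    apply: cvgD; apply: cvgM.
    - exact: (continuous_fst c1).
    - exact: (continuous_fst c2).
    - exact: (continuous_snd c1).
    - exact: (continuous_snd c2).
  have := cG; rewrite /continuous_at => /(cvgr_gt (G (t, s)))/(_ 0).
  have -> : 0 < G (t, s) by apply: dotp_gt0; exact: F0.
  by move=> /(_ isT).
pose A := [set s : R | has_closed_angle (fun t => F (t, s))].
have transfer s : \forall s' \near s, A s <-> A s'.
  apply: filterS (close s) => s' Hs'; split; apply: has_closed_angle_dotp; rewrite ?Floop//.
  by move=> t; move: (Hs' t); rewrite /dotp [X in X + _]mulrC [X in _ + X]mulrC.
have oA : open A.
  by rewrite openE => s As; apply: filterS (transfer s) => s' [/(_ As)].
have cA : closed A.
  rewrite -[A]setCK; apply: open_closedC; rewrite openE => s As.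
  by apply: filterS (transfer s) => s' [_ h] /h.
move=> A1; have : connected [set: R] by apply/connected_intervalP.
move=> /(_ A) AT.
suff -> : has_closed_angle (fun t => F (t, 0)) = A 0 by rewrite AT//;
  [exists 1|exists A; rewrite ?setTI|exists A; rewrite ?setTI].
by [].
Qed.

(** The difference [D] between the angle [2 * pi * t] of the circle and a
    continuous angle is constant modulo [2 * pi], whereas it would have to
    increase by [2 * pi] from [0] to [1], and to take on the way the value
    [D 0 + pi]. *)
Lemma circle_no_closed_angle f : (forall t, 0 <= t <= 1 ->
    f t = (cos (t * (pi *+ 2)), sin (t * (pi *+ 2)))) -> ~ has_closed_angle f.
Proof.
move=> fE [e [Phi [cPhi Phi01 fPhi]]].
pose D t := t * (pi *+ 2) - Phi t.
have DE t : 0 <= t <= 1 -> exists2 r, 0 < r & cos (D t) = r * e.1 /\ sin (D t) = r * e.2.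
  move=> t01; have [r r0] := fPhi t; rewrite fE// => -[c s]; exists r => //.
  rewrite cosB sinB c s /GRing.scale /=; have := cos2Dsin2 (Phi t).
  move: (cos (Phi t)) (sin (Phi t)) => a b ab.
  by split; rewrite -[RHS]mulr1 -ab /=; ring.
have D1 : D 1 = D 0 + pi *+ 2 by rewrite /D mul1r mul0r sub0r -Phi01 addrC.
have pi0 := @pi_gt0 R.
have [] := @IVT R D 0 1 (D 0 + pi) ler01.
- apply: continuous_subspaceT => t; apply: cvgB; last exact: cPhi.
  by apply: cvgMr_tmp; exact: cvg_id.
- rewrite D1 min_l ?max_r; lra.
move=> t; rewrite in_itv /= => t01 Dt.
have [r r0 [ct st]] := DE t t01; have [|r' r'0 [c0 s0]] := DE 0; first lra.
move: ct st; rewrite Dt cosDpi sinDpi c0 s0 => h1 h2.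
have e1 : e.1 = 0 by nra.
have e2 : e.2 = 0 by nra.
by have := cos2Dsin2 (D 0); rewrite c0 s0 e1 e2 !mulr0 expr0n/= addr0; lra.
Qed.

(** Were the circle inside [Omega], it could be contracted there without ever
    meeting [w], although its angle seen from [w] grows by a full turn.  The
    directions of a point of the circle from [w] and from the center [v] make
    an acute angle, so that both grow by the same number of turns. *)
Lemma circle_meets_complement (Omega : set (R * R)) v w (r : R) :
    simply_connected_domain Omega -> ~ Omega w -> eucl_norm (w - v) < r ->
  exists2 t, 0 <= t <= 1 &
    ~ Omega (v + r *: (cos (t * (pi *+ 2)), sin (t * (pi *+ 2)))).
Proof.
move=> [_ sc] Ow wr; apply: contrapT => noT.
have r0 : 0 < r by apply: le_lt_trans wr; exact: eucl_norm_ge0.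
pose c (t : R) : R * R := (cos (t * (pi *+ 2)), sin (t * (pi *+ 2))).
pose g t := v + r *: c t.
have Og t : 0 <= t <= 1 -> Omega (g t).
  by move=> t01; apply: contrapT => nO; apply: noT; exists t.
have cc : continuous c.
  move=> t; have m : {for t, continuous (fun t : R => t * (pi *+ 2) : R)}.
    by apply: cvgMr_tmp; exact: cvg_id.
  by apply: continuous_at_pair; apply: continuous_comp m _;
    [exact: continuous_cos|exact: continuous_sin].
have cg : continuous g.
  by move=> t; apply: cvgD; [exact: cvg_cst|apply: cvgZl_tmp; exact: cc].
have c01 : c 0 = c 1 by rewrite /c mul0r mul1r cos0 sin0 cos2pi sin2pi.
have [] := sc g.
  split; [exact: continuous_subspaceT|by move=> t; rewrite in_itv; exact: Og|].
  by rewrite /g c01.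
move=> H [cH OH H0 H1 Hs].
(* [H] is continuous on the unit square only, and is extended by projection *)
pose cl (t : R) := Num.max 0 (Num.min t 1).
have cl01 t : 0 <= cl t <= 1.
  by rewrite /cl le_max lexx /= ge_max ler01 /= ge_min lexx orbT.
have clK t : 0 <= t <= 1 -> cl t = t.
  by move=> /andP[t0 t1]; rewrite /cl min_l// max_r.
have ccl : continuous cl.
  move=> t; apply: (@continuous_max _ R (cst 0) (fun t => Num.min t 1)); first exact: cvg_cst.
  by apply: (@continuous_min _ R id (cst 1)); [exact: cvg_id|exact: cvg_cst].
have icl t : cl t \in `[0, 1] by rewrite in_itv; exact: cl01.
pose F (z : R * R) := H (cl z.1, cl z.2) - w.
have cF : continuous F.
  move=> z; apply: cvgB; last exact: cvg_cst.
  have /subspace_continuousP/(_ (cl z.1, cl z.2)) := cH.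
  move=> /(_ (conj (icl _) (icl _))) cHz.
  apply: cvg_trans cHz => B /= HB.
  have cz : {for z, continuous (fun z : R * R => (cl z.1, cl z.2))}.
    apply: continuous_at_pair.
      by apply: (@continuous_comp _ _ _ fst cl); [exact: cvg_fst|exact: ccl].
    by apply: (@continuous_comp _ _ _ snd cl); [exact: cvg_snd|exact: ccl].
  have := cz _ HB; rewrite /nbhs /=; apply: filterS => y /=; apply.
  by split; exact: icl.
have cl0 : cl 0 = 0 by rewrite clK// lexx ler01.
have cl1 : cl 1 = 1 by rewrite clK// lexx ler01.
have Floop s : F (0, s) = F (1, s).
  by rewrite /F /= cl0 cl1 (Hs _ (icl s)).1 (Hs _ (icl s)).2.
have F0 z : F z != 0.
  by rewrite subr_eq0; apply/eqP => Hw; apply: Ow; rewrite -Hw; exact: OH.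
have angle1 : has_closed_angle (fun t => F (t, 1)).
  rewrite (_ : (fun t => _) = fun=> g 0 - w); first exact: has_closed_angle_cst.
  by apply/funext => t; rewrite /F /= cl1 H1.
have Fcl t s : F (t, s) = F (cl t, s) by rewrite /F /= (clK (cl t)).
have := has_closed_angle_homotopy cF cl01 Fcl F0 Floop angle1.
move=> angle0; apply: (@circle_no_closed_angle (c \o cl)).
  by move=> t t01; rewrite /= clK.
apply: has_closed_angle_dotp angle0.
- move=> t; apply: (@continuous_comp _ _ _ (fun t => (t, 0)) F); last exact: cF.
  apply: continuous_at_pair; [exact: cvg_id|exact: cvg_cst].
- by move=> t; apply: continuous_comp (ccl t) _; exact: cc.
- exact: Floop.
- by rewrite /= cl0 cl1 c01.
move=> t; rewrite /F /= cl0 H0// /g -[X in X - w]addrC -addrA.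
have := cos2Dsin2 (cl t * (pi *+ 2)).
have := sqr_eucl_norm (v - w); rewrite eucl_distC in wr.
rewrite /dotp /c /=.
move: (cos _) (sin _) => a b; have := eucl_norm_ge0 (v - w).
move: (eucl_norm _) wr => n nr n0 nE ab.
have : - n <= (v - w).1 * a + (v - w).2 * b.
  have [|ge] := leP 0 ((v - w).1 * a + (v - w).2 * b); first lra.
  suff : ((v - w).1 * a + (v - w).2 * b) ^+ 2 <= n ^+ 2 by nra.
  have := sqr_ge0 ((v - w).1 * b - (v - w).2 * a); rewrite nE; move: nE ab => /=.
  move=> nE ab h.
  rewrite -[X in _ <= X]mulr1 -ab.
  by nra.
have -> : (r * a + (v.1 - w.1)) * a + (r * b + (v.2 - w.2)) * b =
    r * (a ^+ 2 + b ^+ 2) + ((v.1 - w.1) * a + (v.2 - w.2) * b) by ring.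
by rewrite ab mulr1 /=; lra.
Qed.

Lemma polar (z : R * R) (t : R) : 0 < t -> eucl_norm z = t ->
  exists a, z = t *: (cos a, sin a).
Proof.
move=> t0 zt; have := sqr_eucl_norm z; rewrite zt => tE.
have z1 : -1 <= z.1 / t <= 1.
  rewrite -ler_norml normrM normfV (gtr0_norm t0) ler_pdivrMr// mul1r -zt.
  exact: ler_fst_eucl_norm.
have zt1 : z.1 = t * (z.1 / t) by rewrite mulrCA divff ?mulr1// gt_eqF.
have zt2 : `|z.2| = t * Num.sqrt (1 - (z.1 / t) ^+ 2).
  apply/eqP; rewrite -(@eqrXn2 _ 2)// ?mulr_ge0 ?sqrtr_ge0 ?(ltW t0)//.
  rewrite exprMn sqr_sqrtr ?real_normK ?num_real//.
    by rewrite mulrBr -exprMn -zt1 tE mulr1 addrC addKr.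
  by rewrite subr_ge0 -(real_normK (num_real _)) expr_le1// ler_norml.
have [z20|z20] := leP 0 z.2.
  exists (acos (z.1 / t)); rewrite acosK// sin_acos//.
  rewrite (surjective_pairing z) {1}zt1; congr pair.
  by rewrite -(ger0_norm z20) zt2.
exists (- acos (z.1 / t)); rewrite cosN sinN acosK// sin_acos//.
rewrite (surjective_pairing z) {1}zt1; apply/pair_equal_spec; split => //.
by rewrite /= scalerN -[LHS]opprK -(ltr0_norm z20) zt2.
Qed.

End Winding.

(** * Chains of small steps inside a domain *)

Section Chains.
Context {R : realType}.
Implicit Types (O : set (R * R)) (v y z : R * R) (s : R).

(** Chains of steps of length at most [s] replace paths: they make connectedness
    quantitative. *)
Inductive chained O s v : R * R -> Prop :=
| chained_refl : O v -> chained O s v v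
| chained_step y z : chained O s v y -> O z -> eucl_norm (z - y) <= s ->
    chained O s v z.

Lemma chained_mem O s v y : chained O s v y -> O y.
Proof. by case. Qed.

Section Grid.
Variables (O : set (R * R)) (s : R) (v : R * R) (L : nat).
Hypothesis s_gt0 : 0 < s.
Hypothesis O_bounded : forall y, O y -> eucl_norm (y - v) <= L%:R * s.

Let n := (L.*2.+1)%N.

Let coord (t : R) : nat := Num.truncn (t / s + L%:R).

Let cell y : 'I_n * 'I_n :=
  (inord (coord (y.1 - v.1)), inord (coord (y.2 - v.2))).

Let center (c : 'I_n * 'I_n) : R * R :=
  (v.1 + s * (c.1%:R - L%:R), v.2 + s * (c.2%:R - L%:R)).

Let coordP (t : R) : `|t| <= L%:R * s ->
  0 <= t - s * ((inord (coord t) : 'I_n)%:R - L%:R) <= s.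
Proof.
rewrite ler_norml => /andP[t1 t2].
have ts1 : - L%:R <= t / s by rewrite ler_pdivlMr// mulNr.
have ts2 : t / s <= L%:R by rewrite ler_pdivrMr.
have h0 : 0 <= t / s + L%:R by lra.
have /andP[k1 k2] := truncn_itv h0.
have kn : (coord t < n)%N.
  rewrite ltnS -(ler_nat R) (le_trans k1)// -addnn natrD; lra.
rewrite inordK//; rewrite -/(coord t) -natr1 in k1 k2 *.
have tE : t = s * (t / s) by rewrite mulrCA divff ?mulr1// gt_eqF.
have s0 := s_gt0; move: k1 k2 tE; move: (t / s) (coord t)%:R => a b k1 k2 ->.
by apply/andP; split; nra.
Qed.

Let cellP y : O y -> 0 <= y.1 - (center (cell y)).1 <= s /\
                     0 <= y.2 - (center (cell y)).2 <= s.
Proof.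
move=> Oy; rewrite /center /= !opprD !addrA; split; apply: coordP.
  exact: le_trans (ler_fst_eucl_norm (y - v)) (O_bounded Oy).
exact: le_trans (ler_snd_eucl_norm (y - v)) (O_bounded Oy).
Qed.

(** A chain may be long, but its points lie in boundedly many cells of side
    [s], and the sequence of cells it visits can be shortened so as to visit
    each of them once.  The points [c] and [c'] of the hypothesis are meant to
    be centers of cells, or ends of the chain. *)
Lemma chained_variation (Phi : R * R -> R) (E : R) y :
    (forall c c' z z', O z -> O z' ->
       `|z.1 - c.1| <= s -> `|z.2 - c.2| <= s ->
       `|z'.1 - c'.1| <= s -> `|z'.2 - c'.2| <= s ->
       `|c'.1 - c.1| <= 2 * s -> `|c'.2 - c.2| <= 2 * s ->
       `|Phi c' - Phi c| <= E) ->
  chained O s v y -> `|Phi y - Phi v| <= (n * n + 2)%:R * E.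
Proof.
move=> PhiE vy.
have Ov : O v by elim: vy.
have E0 : 0 <= E.
  apply: le_trans (normr_ge0 _) (PhiE v v v v Ov Ov _ _ _ _ _ _);
  by rewrite subrr normr0 ?mulr_ge0// ltW.
pose e := [rel a b | `[< exists z z', [/\ O z, O z',
   eucl_norm (z' - z) <= s, cell z = a & cell z' = b] >]].
have con : connect e (cell v) (cell y).
  elim: vy => [_|z z' vz IH Oz' zz']; first exact: connect0.
  apply: connect_trans IH _; apply: connect1; apply/asboolP.
  by exists z, z'; split => //; exact: chained_mem vz.
have near_cell z : O z -> `|Phi (center (cell z)) - Phi z| <= E.
  move=> Oz; have [h1 h2] := cellP Oz.
  by apply: (PhiE _ _ z z) => //; rewrite ?subrr ?normr0 ?ler_norml; lra.
have edge a b : e a b -> `|Phi (center b) - Phi (center a)| <= E.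
  move=> /asboolP[z [z' [Oz Oz' zz' <- <-]]].
  have [h1 h2] := cellP Oz; have [h1' h2'] := cellP Oz'.
  have := le_trans (ler_fst_eucl_norm (z' - z)) zz'; rewrite ler_norml => /= k1.
  have := le_trans (ler_snd_eucl_norm (z' - z)) zz'; rewrite ler_norml => /= k2.
  by apply: (PhiE _ _ z z') => //; rewrite ?ler_norml; lra.
have along a p : path e a p ->
    `|Phi (center (last a p)) - Phi (center a)| <= (size p)%:R * E.
  elim: p a => [|b p IH] a /=; first by rewrite subrr normr0 mul0r.
  move=> /andP[/edge ab /IH bp].
  rewrite -natr1 mulrDl mul1r (le_trans _ (lerD bp ab))//.
  by rewrite (le_trans _ (ler_normD _ _))// addrA subrK.
have /connectP[p0 p0e yE] := con; move: yE; case/shortenP: p0e => p ep up _ yE.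
have sp : (size p <= n * n)%N.
  have := max_card (mem (cell v :: p)); rewrite (card_uniqP up) card_prod card_ord.
  exact: ltnW.
have h1 := near_cell _ Ov; have h2 := near_cell _ (chained_mem vy).
have := along _ _ ep; rewrite -yE => h3.
have h4 : (size p)%:R * E <= (n * n)%:R * E by rewrite ler_wpM2r// ler_nat.
rewrite natrD mulrDl.
by move: h1 h2 h3; rewrite !ler_norml; lra.
Qed.

End Grid.

End Chains.

(** * Exits from the part of a domain far from its boundary *)

Section Exits.
Context {R : realType}.
Variable Omega : set (R * R).
Hypothesis Omega_sc : simply_connected_domain Omega.
Hypothesis Omega_proper : Omega `<` [set: R * R].
Implicit Types v y z : R * R.
Local Notation d := (dist_boundary Omega).

Let oO : open Omega. Proof. by case: Omega_sc.1. Qed.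
Let nO : Omega !=set0. Proof. by case: Omega_sc.1. Qed.

(** Both inequalities are large, so that a point at which a path leaves the
    interior of this set still belongs to it. *)
Definition deep v (delta : R) : set (R * R) :=
  [set y | [/\ Omega y, delta * d v <= d y & eucl_norm (y - v) <= 5 / 4 * d v]].

Section Candidates.
Variables (v : R * R) (delta s : R) (N : nat).
Hypothesis Omega_v : Omega v.
Hypothesis delta_gt0 : 0 < delta.
Hypothesis delta_le : delta <= 1 / 8.
Hypothesis s_gt0 : 0 < s.
Hypothesis N_le : N%:R * (16 * delta) <= 1.

Local Notation rho := (d v).
Local Notation reach := (chained (deep v delta) s v).

Let rho_gt0 : 0 < rho. Proof. exact: dist_boundary_gt0. Qed.

Let lip x y : d x <= d y + eucl_norm (x - y). Proof. exact: dist_boundary_lip. Qed.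

Let deltarho_gt0 : 0 < delta * rho. Proof. exact: mulr_gt0. Qed.

Let reach_v : reach v.
Proof.
apply: chained_refl; split => //; last by rewrite subrr eucl_norm0; have := rho_gt0; lra.
by rewrite ler_piMl ?ltW//; have := delta_le; lra.
Qed.

(** At the last parameter where [g] is reachable, [d] is at least
    [delta * rho]; if it were larger, a further small step would be allowed. *)
Lemma exit_point (g : R -> R * R) : continuous g ->
    (forall t, 0 <= t <= 1 -> eucl_norm (g t - v) <= 5 / 4 * rho) ->
    reach (g 0) -> ~ reach (g 1) ->
  exists t, [/\ 0 <= t <= 1, reach (g t) & d (g t) = delta * rho].
Proof.
move=> cg gv g0 g1.
pose E := [set t : R | 0 <= t <= 1 /\ reach (g t)].
have E0 : E 0 by split; [rewrite lexx ler01|].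
have E1 : ubound E 1 by move=> t [/andP[]].
have supE : has_sup E by split; [exists 0|exists 1].
have t01 : 0 <= sup E <= 1.
  by rewrite ub_le_sup//=; [apply: ge_sup => //; exists 0|exists 1].
have close (e : R) : 0 < e -> exists2 h : R, 0 < h &
    forall t, `|sup E - t| < h -> eucl_norm (g t - g (sup E)) < e.
  move=> e0; have /cg [h /= h0 gh] : nbhs (g (sup E)) [set y | eucl_norm (y - g (sup E)) < e].
    by apply/nearE_eucl; exists e.
  by exists h => // t /gh.
have adh (e : R) : 0 < e -> exists2 y, reach y & eucl_norm (y - g (sup E)) < e.
  move=> /close[h h0 gh]; have [t Et tE] := sup_adherent h0 supE.
  exists (g t); first by case: Et.
  have := ub_le_sup (ex_intro _ 1 E1) Et => ts.
  by apply: gh; rewrite ger0_norm; lra.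
have ds : delta * rho <= d (g (sup E)).
  apply/ler_addgt0Pr => e /adh[y /chained_mem[_ dy _]] yg.
  by apply: le_trans dy _; apply: le_trans (lip _ (g (sup E))) _; lra.
have Os : deep v delta (g (sup E)).
  split => //; last exact: gv.
  have [y /chained_mem[Oy dy _]] := adh _ deltarho_gt0.
  by rewrite eucl_distC => yg; apply: near_Omega Oy _ => //; lra.
have rs : reach (g (sup E)).
  have [y yr yg] := adh _ s_gt0; apply: chained_step yr Os _.
  by rewrite eucl_distC ltW.
exists (sup E); split => //; apply/eqP; rewrite eq_le ds andbT leNgt.
apply/negP => lt_ds.
have s1 : sup E < 1.
  rewrite lt_neqAle (andP t01).2 andbT; apply/eqP => s1.
  by apply: g1; rewrite -s1.
have [h h0 gh] : exists2 h : R, 0 < h & forall t, `|sup E - t| < h ->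
    eucl_norm (g t - g (sup E)) < Num.min s (d (g (sup E)) - delta * rho).
  by apply: close; rewrite lt_min s_gt0/=; lra.
pose m := Num.min (h / 2) (1 - sup E).
have m0 : 0 < m by rewrite lt_min; apply/andP; split; lra.
have m1 : m <= 1 - sup E by rewrite ge_min lexx orbT.
have mh : m <= h / 2 by rewrite ge_min lexx.
have := gh (sup E + m); rewrite opprD addNKr normrN gtr0_norm//.
rewrite lt_min => /(_ _)/andP[|st dt]; first lra.
suff : E (sup E + m).
  by move=> /(ub_le_sup (ex_intro _ 1 E1)); lra.
split; first lra.
apply: chained_step rs _ (ltW st); split; last by apply: gv; lra.
  by case: Os => Os _ _; apply: near_Omega Os _ => //; have := deltarho_gt0; lra.
by have := lip (g (sup E)) (g (sup E + m)); rewrite eucl_distC; lra.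
Qed.

Let exit_points := exists y : nat -> R * R,
  [/\ forall i, (i < N)%N -> reach (y i) /\ d (y i) = delta * rho &
      forall i j, (i < j < N)%N -> 4 * (delta * rho) <= eucl_norm (y j - y i)].

Let t_ (i : nat) := rho + i.+1%:R * (4 * (delta * rho)).

Let iN (i : nat) : (i < N)%N -> i.+1%:R * (4 * (delta * rho)) <= rho / 4.
Proof.
move=> iN; have : i.+1%:R <= N%:R :> R by rewrite ler_nat.
have := rho_gt0; have := deltarho_gt0; have := N_le.
move: (i.+1%:R) (N%:R : R) => a b h1 h2 h3 h4.
have h5 : b * (16 * delta) * rho <= 1 * rho by rewrite ler_wpM2r// ltW.
have h6 : a * (delta * rho) <= b * (delta * rho) by rewrite ler_wpM2r// ltW.
by lra.
Qed.

Let circle (t a : R) : R * R := v + t *: (cos a, sin a).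

Let continuous_circle t : continuous (circle t).
Proof.
move=> a; apply: cvgD; [exact: cvg_cst|apply: cvgZl_tmp].
by apply: continuous_at_pair; [exact: continuous_cos|exact: continuous_sin].
Qed.

Let circle_norm t a : 0 <= t -> eucl_norm (circle t a - v) = t.
Proof.
move=> t0; rewrite /circle addrC addKr eucl_normZ ger0_norm//.
by rewrite /eucl_norm /= cos2Dsin2 sqrtr1 mulr1.
Qed.

(** A circle around [v] of radius larger than [rho] meets the complement of
    [Omega]; if it also contains a reachable point, then an exit point lies on
    the arc between them. *)
Let exit_points_on_circles :
  (forall i, (i < N)%N -> exists2 z, reach z & eucl_norm (z - v) = t_ i) ->
  exit_points.
Proof.
move=> circ; have [rho0 dr0] := (rho_gt0, deltarho_gt0).
have t0 i : rho < t_ i by rewrite /t_ ltrDl mulr_gt0// mulr_gt0.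
have pt i : exists y, (i < N)%N ->
    [/\ reach y, d y = delta * rho & eucl_norm (y - v) = t_ i].
  have [iltN|] := boolP (i < N)%N; last by exists v.
  have [z zr zt] := circ i iltN.
  have [w /boundaryE[//|_ Ow] wv] := dist_boundary_adherent oO Omega_proper nO (t0 i).
  rewrite eucl_distC in wv.
  have [b b01 Ob] := circle_meets_complement Omega_sc Ow wv.
  have [a za] := polar (lt_trans rho0 (t0 i)) zt.
  pose g (l : R) := circle (t_ i) (a + l * (b * (pi *+ 2) - a)).
  have cg : continuous g.
    move=> l; apply: (@continuous_comp _ _ _
      (fun l : R => a + l * (b * (pi *+ 2) - a)) (circle (t_ i))).
      by apply: cvgD; [exact: cvg_cst|apply: cvgMr_tmp; exact: cvg_id].
    exact: continuous_circle.
  have gv l : 0 <= l <= 1 -> eucl_norm (g l - v) <= 5 / 4 * rho.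
    move=> _; rewrite circle_norm ?(ltW (lt_trans rho0 (t0 i)))//.
    by have := iN iltN; rewrite /t_; lra.
  have g0 : reach (g 0) by rewrite /g /circle mul0r addr0 -za addrC subrK.
  have g1 : ~ reach (g 1).
    by rewrite /g /circle mul1r subrKC => /chained_mem[].
  have [l [_ gl1 gl2]] := exit_point cg gv g0 g1.
  by exists (g l) => _; split => //; rewrite circle_norm// (ltW (lt_trans rho0 (t0 i))).
exists (fun i => projT1 (cid (pt i))); split => [i iltN|i j /andP[ij jN]].
  by case: cid => /= y /(_ iltN)[].
case: cid => /= y /(_ jN)[_ _ yj]; case: cid => /= z /(_ (ltn_trans ij jN))[_ _ zi].
have := ler_eucl_distD z y v; rewrite yj zi /t_.
have : i.+1%:R + 1 <= j.+1%:R :> R by rewrite natr1 ler_nat.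
move: (i.+1%:R) (j.+1%:R : R) => a b h; rewrite -lerBlDr; apply: le_trans.
by have := mulr_gt0 (ltr0n R 4) dr0; nra.
Qed.

(** If the reachable set misses one of these circles, it is enclosed by it,
    and each horizontal line through the inner disk carries an exit point. *)
Let exit_points_on_lines i0 : (i0 < N)%N ->
  (forall z, reach z -> eucl_norm (z - v) <> t_ i0) -> exit_points.
Proof.
move=> i0N circ; have [rho0 dr0] := (rho_gt0, deltarho_gt0).
have drho8 : delta * rho <= rho / 8.
  by have : delta * rho <= 1 / 8 * rho by [rewrite ler_wpM2r// ltW|]; lra.
have t0 : rho < t_ i0 by rewrite /t_ ltrDl mulr_gt0// mulr_gt0.
have t5 : t_ i0 <= 5 / 4 * rho by have := iN i0N; rewrite /t_; lra.
pose h (i : nat) := i%:R * (4 * (delta * rho)).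
have h0 i : 0 <= h i by rewrite mulr_ge0// mulr_ge0// ltW.
have h4 i : (i < N)%N -> h i <= rho / 4.
  by move=> /iN; rewrite /h -natr1 mulrDl; lra.
have pt i : exists y, (i < N)%N -> [/\ reach y, d y = delta * rho & y.2 - v.2 = h i].
  have [iltN|] := boolP (i < N)%N; last by exists v.
  have hi4 := h4 _ iltN; have hi0 := h0 i.
  pose p := v + (0, h i).
  have pr : reach p.
    apply: contrapT => np; pose g (l : R) := v + l *: (0, h i).
    have cg : continuous g.
      by move=> l; apply: cvgD; [exact: cvg_cst|apply: cvgZr_tmp; exact: cvg_id].
    have gvE l : 0 <= l <= 1 -> eucl_norm (g l - v) <= rho / 4.
      move=> /andP[l0 l1]; rewrite /g addrC addKr eucl_normZ ger0_norm//.
      apply: le_trans (_ : h i <= _) => //; rewrite -[leRHS]mul1r ler_pM ?eucl_norm_ge0//.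
      by rewrite (le_trans (eucl_norm_le_sum _))//= normr0 add0r ger0_norm.
    have gv l : 0 <= l <= 1 -> eucl_norm (g l - v) <= 5 / 4 * rho.
      by move=> /gvE; lra.
    have g0 : reach (g 0) by rewrite /g scale0r addr0; exact: reach_v.
    have g1 : ~ reach (g 1) by rewrite /g scale1r.
    have [l [/gvE glv _ gl2]] := exit_point cg gv g0 g1.
    by have := lip v (g l); rewrite eucl_distC gl2; lra.
  (* the horizontal line at height [h i] meets the circle at abscissa [k] *)
  pose k := Num.sqrt (t_ i0 ^+ 2 - h i ^+ 2).
  have k2 : k ^+ 2 = t_ i0 ^+ 2 - h i ^+ 2.
    rewrite sqr_sqrtr// subr_ge0 ler_pXn2r ?nnegrE//; lra.
  pose g (l : R) := v + (l * k, h i).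
  have cg : continuous g.
    move=> l; apply: cvgD; first exact: cvg_cst.
    apply: (@continuous_at_pair _ _ (fun l : R => l * k) (fun=> h i) l); last exact: cvg_cst.
    by apply: cvgMr_tmp; exact: cvg_id.
  have gv l : 0 <= l <= 1 -> eucl_norm (g l - v) <= 5 / 4 * rho.
    move=> /andP[l0 l1]; apply: le_trans t5; rewrite /g addrC addKr.
    rewrite eucl_norm_le /=; last lra.
    have : l ^+ 2 <= 1 by rewrite expr_le1.
    rewrite exprMn k2; have : 0 <= t_ i0 ^+ 2 - h i ^+ 2 by rewrite -k2 sqr_ge0.
    by move: (l ^+ 2) (t_ i0 ^+ 2) (h i ^+ 2) => A B C; nra.
  have g0 : reach (g 0) by rewrite /g mul0r.
  have g1 : ~ reach (g 1).
    move=> /circ; apply; rewrite /g addrC addKr /eucl_norm /= mul1r k2 subrK.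
    by rewrite sqrtr_sqr ger0_norm//; lra.
  have [l [_ gl1 gl2]] := exit_point cg gv g0 g1.
  by exists (g l) => _; split => //; rewrite /g /= addrC addKr.
exists (fun i => projT1 (cid (pt i))); split => [i iltN|i j /andP[ij jN]].
  by case: cid => /= y /(_ iltN)[].
case: cid => /= y /(_ jN)[_ _ yj]; case: cid => /= z /(_ (ltn_trans ij jN))[_ _ zi].
apply: le_trans (ler_snd_eucl_norm _); apply: le_trans (ler_norm _) => /=.
rewrite (_ : y.2 - z.2 = h j - h i); last by rewrite -yj -zi; lra.
have : i%:R + 1 <= j%:R :> R by rewrite natr1 ler_nat.
rewrite /h; move: (i%:R) (j%:R : R) => a b ab.
by have := mulr_gt0 (ltr0n R 4) dr0; nra.
Qed.

(** The bound on [N] keeps the radii below [5/4 * rho], while leaving a gap of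
    [4 * delta * rho] between exit points, enough for the disks of radius
    [3/2 * delta * rho] around them to be disjoint. *)
Lemma separated_exit_points : exit_points.
Proof.
have [circ|] := pselect (forall i, (i < N)%N ->
    exists2 z, reach z & eucl_norm (z - v) = t_ i).
  exact: exit_points_on_circles.
move=> /existsNP[i /not_implyP[iN' nz]]; apply: (exit_points_on_lines iN').
by move=> z zr zt; apply: nz; exists z.
Qed.

End Candidates.
End Exits.

(** * Integration over squares *)

Section PlaneMeasure.
Context {R : realType}.
Local Notation plane := (measurableTypeR R * measurableTypeR R)%type.
Local Notation mu := (@lebesgue_measure R).
Local Notation mu2 := (@lebesgue2 R).
Implicit Types (A : set (R * R)) (f : R * R -> R).

(** Here the plane carries the product of the Borel sigma-algebras of the line;
    an open set is the countable union of the rational boxes it contains. *)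
Lemma open_measurable_plane A : open A -> measurable (A : set plane).
Proof.
move=> oA.
pose box (q1 q2 : rat) (n : nat) : set plane :=
  ball (ratr q1 : R) n.+1%:R^-1 `*` ball (ratr q2 : R) n.+1%:R^-1.
have mbox q1 q2 n : measurable (box q1 q2 n).
  by apply: measurableX; apply: open_measurable; exact: ball_open.
pose F q1 q2 n := if `[< box q1 q2 n `<=` A >] then box q1 q2 n else set0.
have -> : A = \bigcup_q1 \bigcup_q2 \bigcup_n F q1 q2 n.
  apply/seteqP; split => [x Ax|x [q1 _ [q2 _ [n _]]]]; last first.
    by rewrite /F; case: asboolP => // + bx; exact.
  have /nbhs_ballP[e /= e0 eA] : nbhs x A by exact: open_nbhs_nbhs.
  have [n ne] : exists n : nat, n.+1%:R^-1 < e / 2.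
    have e2 : 0 < e / 2 by lra.
    exists (Num.truncn (e / 2)^-1).
    by rewrite invf_plt ?posrE// truncnS_gt.
  have n0 : 0 < n.+1%:R^-1 :> R by rewrite invr_gt0.
  have near_rat (r t : R) : 0 < r -> exists q : rat, `|ratr q - t| < r.
    move=> r0; have /rat_in_itvoo[q] : t - r < t + r by lra.
    by rewrite in_itv /= => h; exists q; rewrite ltr_norml; lra.
  have [q1 q1x] := near_rat _ x.1 n0; have [q2 q2x] := near_rat _ x.2 n0.
  exists q1 => //; exists q2 => //; exists n => //.
  rewrite /F; case: asboolP => [_|]; first by split; rewrite /ball /=.
  case => y [/= y1 y2]; apply: eA.
  move: y1 y2 q1x q2x; rewrite /ball /= => y1 y2 x1 x2.
  have tri (r a b c : R) : r < e / 2 -> `|a - c| < r -> `|a - b| < r -> `|c - b| < e.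
    by rewrite !ltr_norml; lra.
  by split; rewrite /ball /=; [apply: tri ne x1 y1|apply: tri ne x2 y2].
apply: bigcupT_measurable_rat => q1; apply: bigcupT_measurable_rat => q2.
by apply: bigcupT_measurable => n; rewrite /F; case: ifP.
Qed.

Lemma continuous_measurable_plane f : continuous f ->
  measurable_fun [set: plane] (f : plane -> R).
Proof.
move=> /continuousP cf; apply: (measurability _ (RGenOpens.measurableE R)).
move=> _ [_ [a [b ->] <-]]; rewrite setTI; apply: open_measurable_plane.
exact/cf/interval_open.
Qed.

Lemma segment_measure (c r : R) : 0 < r ->
  mu `[c - r, c + r]%classic = (2 * r)%:E.
Proof.
move=> r0; rewrite lebesgue_measure_itv /= lte_fin ifT; last lra.
by rewrite -EFinB; congr EFin; lra.
Qed.

Definition square (c : R * R) (r : R) : set (R * R) :=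
  `[c.1 - r, c.1 + r]%classic `*` `[c.2 - r, c.2 + r]%classic.

Lemma squareP (c z : R * R) (r : R) :
  square c r z <-> `|z.1 - c.1| <= r /\ `|z.2 - c.2| <= r.
Proof.
rewrite /square /= !in_itv /= !ler_norml; split => -[h1 h2]; split; lra.
Qed.

Lemma measurable_square c r : measurable (square c r : set plane).
Proof. by apply: measurableX; exact: measurable_itv. Qed.

Lemma square_measure c (r : R) : 0 < r ->
  mu2 (square c r) = (4 * r ^+ 2)%:E.
Proof.
move=> r0; have -> : mu2 (square c r) =
    (mu `[(c.1 - r)%R, (c.1 + r)%R]%classic * mu `[(c.2 - r)%R, (c.2 + r)%R]%classic)%E.
  by apply: product_measure1E; exact: measurable_itv.
have [-> ->] := (segment_measure c.1 r0, segment_measure c.2 r0).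
by rewrite -EFinM; congr EFin; ring.
Qed.

Section GoodLine.
Variables (f : R * R -> R) (I J : set R) (s : R).
Hypothesis cf : continuous f.
Hypothesis f0 : forall z, 0 <= f z.
Hypothesis mI : measurable I.
Hypothesis mJ : measurable J.
Hypothesis s0 : 0 < s.
Hypothesis muJ : mu J = (2 * s)%:E.

(** Chebyshev's inequality: a function on [J] of integral [K] is somewhere at
    most [K / s], which is twice its mean value.  The loss of this factor makes
    the case where [K] is positive strict; when [K] vanishes, so does the
    function almost everywhere.  The point is chosen before [k], so that
    an infinite [K] is covered too. *)
Let exists_le (G : R -> \bar R) (K : \bar R) :
  measurable_fun setT G -> (forall y, 0 <= G y)%E ->
  (K = \int[mu]_(y in J) G y)%E ->
  exists2 y, J y & forall k : R, 0 <= k -> (K <= k%:E)%E -> (G y <= (k / s)%:E)%E.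
Proof.
move=> mG G0 KE.
have J0 : J !=set0.
  by apply/set0P/eqP => J0; move: muJ; rewrite J0 measure0 => -[]; have := s0; lra.
have mGJ : measurable_fun J G by exact: measurable_funS mG.
have K0 : (0 <= K)%E by rewrite KE; exact: integral_ge0.
case: K KE K0 => [k| |] // KE k0; last first.
  by have [y Jy] := J0; exists y.
rewrite lee_fin in k0.
suff [y Jy Gy] : exists2 y, J y & (G y <= (k / s)%:E)%E.
  exists y => // k' k'0; rewrite lee_fin => kk'; apply: le_trans Gy _.
  by rewrite lee_fin ler_pM2r// invr_gt0.
apply: contrapT => nG.
have {}nG y : J y -> ((k / s)%:E < G y)%E.
  by move=> Jy; rewrite ltNge; apply/negP => Gy; apply: nG; exists y.
have [kgt0|kle0] := ltP 0 k.
  have : (\int[mu]_(y in J) (k / s)%:E <= \int[mu]_(y in J) G y)%E.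
    apply: ge0_le_integral => //.
    - by move=> y _; rewrite lee_fin divr_ge0// ltW.
    - by move=> y Jy; exact: ltW (nG y Jy).
  have -> : (\int[mu]_(y in J) (k / s)%:E = (k / s * (2 * s))%:E)%E.
    by rewrite (EFinM (k / s)) -muJ; exact: integral_cst.
  have -> : k / s * (2 * s) = 2 * k by field; rewrite gt_eqF.
  by rewrite -KE lee_fin; lra.
have k00 : k = 0 by lra.
have : (\int[mu]_(y in J) `|G y| = 0)%E.
  by rewrite -[RHS]/(0%:E) -k00 KE; apply: eq_integral => y _; rewrite gee0_abs.
move=> /(ae_eq_integral_abs mu mJ mGJ) -[N [mN N0 JN]].
have : (mu J <= mu N)%E.
  apply: le_measure; rewrite ?inE// => y Jy; apply: JN => /= /(_ Jy) Gy0.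
  by have := nG y Jy; rewrite Gy0 k00 mul0r ltxx.
by rewrite N0 muJ lee_fin; have := s0; lra.
Qed.

Let mf_patch (A : set plane) : measurable A ->
  measurable_fun setT ((EFin \o f) \_ A : plane -> \bar R).
Proof.
move=> mA; apply/(measurable_restrictT _ _).1 => //.
by apply/measurable_EFinP; apply: measurable_funTS; exact: continuous_measurable_plane.
Qed.

Let patch_ge0 (A : set plane) z : (0 <= ((EFin \o f) \_ A) z)%E.
Proof. by apply: erestrict_ge0 => y _; rewrite lee_fin. Qed.

(** By Tonelli's theorem, the line integrals along the segments [I] at height
    [y] have the integral over the rectangle as their own integral over [J]. *)
Lemma good_horizontal_line : exists2 y, J y & forall k : R, 0 <= k ->
  (\int[mu2]_(z in I `*` J) (f z)%:E <= k%:E)%E ->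
  (\int[mu]_(x in I) (f (x, y))%:E <= (k / s)%:E)%E.
Proof.
have mIJ : measurable (I `*` J : set plane) by exact: measurableX.
pose h := (EFin \o f) \_ (I `*` J) : plane -> \bar R.
have GE y : J y -> (\int[mu]_x h (x, y) = \int[mu]_(x in I) (f (x, y))%:E)%E.
  move=> Jy; rewrite [RHS]integral_mkcond; apply: eq_integral => x _.
  by rewrite /h /patch in_setX (mem_set Jy) andbT.
have [|||y Jy H] := @exists_le (fubini_G mu h) (\int[mu2]_(z in I `*` J) (f z)%:E)%E.
- exact: measurable_fun_fubini_tonelli_G (mf_patch mIJ) (patch_ge0 _).
- by move=> y; apply: integral_ge0 => x _; exact: patch_ge0.
- rewrite integral_mkcond /lebesgue2 (fubini_tonelli2 h (mf_patch mIJ) (patch_ge0 _)).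
  rewrite [RHS]integral_mkcond; apply: eq_integral => y _.
  rewrite /patch; case: ifPn => // yJ; apply: integral0_eq => x _.
  by rewrite /h /patch in_setX (negbTE yJ) andbF.
by exists y => // k k0 /(H k k0); rewrite /fubini_G GE.
Qed.

Lemma good_vertical_line : exists2 x, J x & forall k : R, 0 <= k ->
  (\int[mu2]_(z in J `*` I) (f z)%:E <= k%:E)%E ->
  (\int[mu]_(y in I) (f (x, y))%:E <= (k / s)%:E)%E.
Proof.
have mJI : measurable (J `*` I : set plane) by exact: measurableX.
pose h := (EFin \o f) \_ (J `*` I) : plane -> \bar R.
have FE x : J x -> (\int[mu]_y h (x, y) = \int[mu]_(y in I) (f (x, y))%:E)%E.
  move=> Jx; rewrite [RHS]integral_mkcond; apply: eq_integral => y _.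
  by rewrite /h /patch in_setX (mem_set Jx).
have [|||x Jx H] := @exists_le (fubini_F mu h) (\int[mu2]_(z in J `*` I) (f z)%:E)%E.
- exact: measurable_fun_fubini_tonelli_F (mf_patch mJI) (patch_ge0 _).
- by move=> x; apply: integral_ge0 => y _; exact: patch_ge0.
- rewrite integral_mkcond /lebesgue2 (fubini_tonelli1 h (mf_patch mJI) (patch_ge0 _)).
  rewrite [RHS]integral_mkcond; apply: eq_integral => x _.
  rewrite /patch; case: ifPn => // xJ; apply: integral0_eq => y _.
  by rewrite /h /patch in_setX (negbTE xJ).
by exists x => // k k0 /(H k k0); rewrite /fubini_F FE.
Qed.

End GoodLine.

Lemma ler_int_derivative (f f' : R -> R) (a b x y : R) :
  (forall t : R, is_derive t 1 f (f' t)) -> continuous f' ->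
  a <= x <= b -> a <= y <= b ->
  (`|f x - f y|%:E <= \int[mu]_(t in `[a, b]) `|f' t|%:E)%E.
Proof.
move=> df cf'; wlog xy : x y / x < y => [wl|] xab yab.
  have [xy|yx|->] := ltgtP x y; first exact: wl.
    by rewrite distrC; exact: wl.
  by rewrite subrr normr0; apply: integral_ge0 => t _; rewrite lee_fin.
have mf' (A : set R) : measurable_fun A (EFin \o f').
  by apply/measurable_EFinP; apply: measurable_funTS; exact: continuous_measurable_fun.
have mnf' (A : set R) : measurable_fun A (fun t => `|f' t|%:E).
  by apply/measurable_EFinP; apply: measurableT_comp => //; apply/measurable_EFinP.
have cf : continuous f.
  by move=> t; apply: differentiable_continuous; apply/derivable1_diffP; case: (df t).
have FTC : (\int[mu]_(t in `[x, y]) (f' t)%:E = (f y)%:E - (f x)%:E)%E.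
  apply: continuous_FTC2 => //.
  - exact: continuous_subspaceT.
  - split => [t _||]; first by case: (df t).
      by apply: cvg_at_right_filter; exact: cf.
    by apply: cvg_at_left_filter; exact: cf.
  - by move=> t _; rewrite derive1E; case: (df t).
apply: (@le_trans _ _ (\int[mu]_(t in `[x, y]) `|f' t|%:E)%E).
  rewrite distrC -abse_EFin EFinB -FTC.
  by apply: le_abse_integral; [exact: measurable_itv|exact: mf'].
apply: ge0_subset_integral; [exact: measurable_itv|exact: measurable_itv|exact: mnf'| |].
  by move=> t _; rewrite lee_fin.
by move=> t /=; rewrite !in_itv /=; lra.
Qed.

End PlaneMeasure.

Section Oscillation.
Context {R : realType}.
Local Notation mu := (@lebesgue_measure R).
Local Notation mu2 := (@lebesgue2 R).
Variable u : R * R -> R.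
Hypothesis u_smooth : smooth u.

Let continuous_partial b : continuous (partial b u).
Proof. exact: (u_smooth [:: b]).1. Qed.

Let is_derive_fst (t y : R) :
  is_derive t 1 (fun t => u (t, y)) (partial false u (t, y)).
Proof.
have H : (fun h : R => h^-1 *: ((fun t => u (t, y)) (h *: 1 + t) - u (t, y))) =
    (fun h => h^-1 *: (u (h *: basis_vec R false + (t, y)) - u (t, y))).
  apply/funext => h; rewrite (_ : h *: basis_vec R false + (t, y) = (h *: 1 + t, y))//.
  by apply/pair_equal_spec; split; rewrite //= scaler0 add0r.
have du := (u_smooth [::]).2 false (t, y).
by apply: DeriveDef; [rewrite /derivable H|rewrite /partial /derive H].
Qed.

Let is_derive_snd (x t : R) :
  is_derive t 1 (fun t => u (x, t)) (partial true u (x, t)).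
Proof.
have H : (fun h : R => h^-1 *: ((fun t => u (x, t)) (h *: 1 + t) - u (x, t))) =
    (fun h => h^-1 *: (u (h *: basis_vec R true + (x, t)) - u (x, t))).
  apply/funext => h; rewrite (_ : h *: basis_vec R true + (x, t) = (x, h *: 1 + t))//.
  by apply/pair_equal_spec; split; rewrite //= scaler0 add0r.
have du := (u_smooth [::]).2 true (x, t).
by apply: DeriveDef; [rewrite /derivable H|rewrite /partial /derive H].
Qed.

Let norm_partial_ge0 b z : 0 <= `|partial b u z|. Proof. exact: normr_ge0. Qed.

Let continuous_norm_partial b : continuous (fun z => `|partial b u z|).
Proof. by move=> z; apply: cvg_norm; exact: continuous_partial. Qed.

(** The coordinates of [z] are chosen independently of each other: [z.2] for the
    horizontal segment through [z], [z.1] for the vertical one. *)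
Let good_point_exists (c : R * R) (s : R) : exists z : R * R, 0 < s ->
  [/\ `|z.1 - c.1| <= s, `|z.2 - c.2| <= s &
   forall k : R, 0 <= k ->
   ((\int[mu2]_(y in square c (3 * s)) `|partial false u y|%:E <= k%:E) ->
    (\int[mu]_(t in `[(c.1 - 3 * s)%R, (c.1 + 3 * s)%R])
       `|partial false u (t, z.2)|%:E <= (k / s)%:E))%E /\
   ((\int[mu2]_(y in square c (3 * s)) `|partial true u y|%:E <= k%:E) ->
    (\int[mu]_(t in `[(c.2 - 3 * s)%R, (c.2 + 3 * s)%R])
       `|partial true u (z.1, t)|%:E <= (k / s)%:E))%E].
Proof.
have [s0|] := ltP 0 s; last by exists c.
pose I (x r : R) := `[x - r, x + r]%classic.
have mI x r : measurable (I x r : set (measurableTypeR R)) by exact: measurable_itv.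
have sub (x : R) t : I x s t -> I x (3 * s) t by rewrite /I /= !in_itv /=; lra.
have inI (x t : R) : I x s t -> `|t - x| <= s.
  by rewrite /I /= in_itv /= ler_norml; lra.
have [y Jy Hy] := good_horizontal_line (@continuous_norm_partial false)
  (norm_partial_ge0 false) (mI c.1 (3 * s)) (mI c.2 s) s0 (segment_measure c.2 s0).
have [x Jx Hx] := good_vertical_line (@continuous_norm_partial true)
  (norm_partial_ge0 true) (mI c.2 (3 * s)) (mI c.1 s) s0 (segment_measure c.1 s0).
have mf b (A : set (measurableTypeR R * measurableTypeR R)) :
    measurable_fun A (fun z : measurableTypeR R * measurableTypeR R => `|partial b u z|%:E).
  apply/measurable_EFinP; apply: measurable_funTS.
  exact: (continuous_measurable_plane (@continuous_norm_partial b)).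
exists (x, y) => _; split; [exact: inI|exact: inI|] => k k0; split => H.
  apply: Hy k0 _; apply: le_trans H.
  apply: ge0_subset_integral; [by apply: measurableX|exact: measurable_square|exact: mf| |].
    by move=> z _; rewrite lee_fin.
  by move=> z [z1 z2]; split => //; exact: sub.
apply: Hx k0 _; apply: le_trans H.
apply: ge0_subset_integral; [by apply: measurableX|exact: measurable_square|exact: mf| |].
  by move=> z _; rewrite lee_fin.
by move=> z [z1 z2]; split => //; exact: sub.
Qed.

Definition good_point (c : R * R) (s : R) : R * R :=
  projT1 (cid (good_point_exists c s)).

Let good_pointP (c : R * R) (s : R) := projT2 (cid (good_point_exists c s)).

Lemma good_point_near c s : 0 < s ->
  `|(good_point c s).1 - c.1| <= s /\ `|(good_point c s).2 - c.2| <= s.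
Proof. by move=> s0; have [] := good_pointP c s0. Qed.

(** Go horizontally from the first good point, then vertically to the second.
    The hypotheses on the centers keep the first segment inside the larger
    square around [c], the second one inside the larger square around [c']. *)
Lemma good_point_variation (c c' : R * R) (s s' k k' : R) :
    0 < s -> 0 < s' -> 0 <= k -> 0 <= k' ->
    `|c'.1 - c.1| + s' <= 3 * s -> `|c'.2 - c.2| + s <= 3 * s' ->
    (\int[mu2]_(y in square c (3 * s)) `|partial false u y|%:E <= k%:E)%E ->
    (\int[mu2]_(y in square c' (3 * s')) `|partial true u y|%:E <= k'%:E)%E ->
  `|u (good_point c' s') - u (good_point c s)| <= k / s + k' / s'.
Proof.
move=> s0 s'0 k0 k'0 h1 h2 ik ik'.
have [z1 z2 /(_ _ k0)[/(_ ik) H _]] := good_pointP c s0.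
have [z1' z2' /(_ _ k'0)[_ /(_ ik') H']] := good_pointP c' s'0.
move: z1 z2 z1' z2' H H'; rewrite -!/(good_point _ _).
move: (good_point c s) (good_point c' s') => [x y] [x' y'] /=.
rewrite !ler_norml => z1 z2 z1' z2' H H'.
have {}h1 : c'.1 - c.1 <= 3 * s - s' /\ - (3 * s - s') <= c'.1 - c.1.
  have : `|c'.1 - c.1| <= 3 * s - s' by lra.
  by rewrite ler_norml; lra.
have {}h2 : c'.2 - c.2 <= 3 * s' - s /\ - (3 * s' - s) <= c'.2 - c.2.
  have : `|c'.2 - c.2| <= 3 * s' - s by lra.
  by rewrite ler_norml; lra.
have cline b (g : R -> R * R) : continuous g -> continuous (fun t => partial b u (g t)).
  by move=> cg t; apply: (@continuous_comp _ _ _ g (partial b u));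
    [exact: cg|exact: continuous_partial].
have A : `|u (x', y) - u (x, y)| <= k / s.
  rewrite -lee_fin; apply: le_trans H.
  apply: (ler_int_derivative (f := fun t => u (t, y)) (fun t => is_derive_fst t y)); [|lra|lra].
  by apply: cline => t; apply: continuous_at_pair; [exact: cvg_id|exact: cvg_cst].
have B : `|u (x', y') - u (x', y)| <= k' / s'.
  rewrite -lee_fin; apply: le_trans H'.
  apply: (ler_int_derivative (f := fun t => u (x', t)) (fun t => is_derive_snd x' t)); [|lra|lra].
  by apply: cline => t; apply: continuous_at_pair; [exact: cvg_cst|exact: cvg_id].
by move: A B; rewrite !ler_norml; lra.
Qed.

End Oscillation.

(** * Weighted energy and good points *)

Section PowerInequalities.
Context {R : realType}.

(** Compare [t] with the level [l].  Integrated, and with [l] of the order of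
    the [q]-mean of [t], this replaces Hoelder's inequality. *)
Lemma ler_level_powR (q l t : R) : 1 < q -> 0 < l -> 0 <= t ->
  t <= l + l `^ (1 - q) * t `^ q.
Proof.
move=> q1 l0 t0; have [tl|lt] := leP t l.
  by rewrite (le_trans tl)// lerDl mulr_ge0 ?powR_ge0.
have t0' : 0 < t by exact: lt_trans lt.
apply: (@le_trans _ _ (l `^ (1 - q) * t `^ q)); last by rewrite lerDr ltW.
rewrite -(mulr_powRB1 t0 (lt_trans ltr01 q1)) mulrCA ler_peMr//.
rewrite -opprB powRN mulrC ler_pdivlMr ?powR_gt0// mul1r.
by apply: ge0_ler_powR; rewrite ?nnegrE ?subr_ge0; lra.
Qed.

(** A power is monotone, in a direction which depends on the sign of [e]. *)
Lemma ler_powR_itv (a b t e : R) : 0 < a -> a <= t <= b ->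
  t `^ e <= a `^ e + b `^ e.
Proof.
move=> a0 /andP[at_ tb]; have [e0|e0] := leP 0 e.
  apply: ler_wpDl; first exact: powR_ge0.
  by apply: ge0_ler_powR; rewrite ?nnegrE//; lra.
apply: ler_wpDr; first exact: powR_ge0.
rewrite -(opprK e) !(powRN _ (- e)) lef_pV2 ?posrE ?powR_gt0//; last lra.
by apply: ge0_ler_powR; rewrite ?nnegrE//; lra.
Qed.

Lemma powRD_gt0 (x r s : R) : 0 < x -> x `^ (r + s) = x `^ r * x `^ s.
Proof. by move=> x0; rewrite powRD//; apply/implyP => _; rewrite gt_eqF. Qed.

End PowerInequalities.

Section IntegralPigeonhole.
Local Open Scope ereal_scope.

Let exists_min {R : realType} (e : nat -> \bar R) (N : nat) : (0 < N)%N ->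
  exists2 i, (i < N)%N & forall j, (j < N)%N -> e i <= e j.
Proof.
case: N => // N _; elim: N => [|N [i iN imin]].
  by exists 0%N => // -[].
have [eiN|/ltW eNi] := leP (e i) (e N.+1).
  exists i; first exact: ltnW.
  by move=> j; rewrite ltnS leq_eqVlt => /predU1P[->//|]; exact: imin.
exists N.+1 => // j; rewrite ltnS leq_eqVlt => /predU1P[->//|jN].
exact: le_trans eNi (imin j jN).
Qed.

Let lee_nat_sum {R : realType} (e : nat -> \bar R) (x : \bar R) (s : seq nat) : 0 <= x ->
  (forall i, i \in s -> x <= e i) -> (size s)%:R%:E * x <= \sum_(i <- s) e i.
Proof.
move=> x0; elim: s => [|i s IH] xe; first by rewrite big_nil /= mul0e.
have -> : (size (i :: s))%:R%:E * x = x + (size s)%:R%:E * x.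
  rewrite /= -(natr1 (size s)) EFinD ge0_muleDl ?lee_fin// addeC.
  by congr (_ + _); exact: mul1e.
rewrite big_cons.
apply: leeD; first by apply: xe; rewrite inE eqxx.
by apply: IH => j js; apply: xe; rewrite inE js orbT.
Qed.

(** Take the set with the smallest integral. *)
Lemma integral_pigeonhole {dT} {T : measurableType dT} {R : realType}
    (mu : {measure set T -> \bar R}) (N : nat) (B : nat -> set T) (A : set T)
    (f : T -> \bar R) : (0 < N)%N ->
    (forall i, measurable (B i)) -> measurable A -> measurable_fun setT f ->
    (forall x, 0 <= f x) ->
    (forall i, (i < N)%N -> B i `<=` A) ->
    (forall i j, (i < j < N)%N -> B i `&` B j = set0) ->
  exists2 i, (i < N)%N & N%:R%:E * \int[mu]_(x in B i) f x <= \int[mu]_(x in A) f x.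
Proof.
move=> N0 mB mA mf f0 sub disj.
have [i iN imin] := exists_min (fun i => \int[mu]_(x in B i) f x) N0.
exists i => //.
have tri : trivIset [set` iota 0 N] B.
  move=> k j /=; rewrite !mem_iota !add0n => kN jN ne; have [kj|jk|//] := ltngtP k j.
    by have /set0P := ne; rewrite disj ?kj// eqxx.
  by have /set0P := ne; rewrite setIC disj ?jk// eqxx.
have mU : measurable (\big[setU/set0]_(i <- iota 0 N) B i) by exact: bigsetU_measurable.
apply: (@le_trans _ _ (\int[mu]_(x in \big[setU/set0]_(i <- iota 0 N) B i) f x)).
  rewrite ge0_integral_bigsetU ?iota_uniq//; last exact: measurable_funTS.
  rewrite -[X in X%:R%:E](size_iota 0 N); apply: lee_nat_sum.
    by apply: integral_ge0 => x _.
  by move=> j; rewrite mem_iota; exact: imin.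
apply: ge0_subset_integral => //; first exact: measurable_funTS.
by rewrite -bigcup_seq => x [k /=]; rewrite mem_iota => kN; exact: sub.
Qed.

End IntegralPigeonhole.

Section Energy.
Context {R : realType}.
Local Notation plane := (measurableTypeR R * measurableTypeR R)%type.
Local Notation mu2 := (@lebesgue2 R).
Variable Omega : set (R * R).
Hypothesis Omega_sc : simply_connected_domain Omega.
Hypothesis Omega_proper : Omega `<` [set: R * R].
Variable u : R * R -> R.
Hypothesis u_smooth : smooth u.
Variables q gamma : R.
Hypothesis q_gt1 : 1 < q.
Local Notation d := (dist_boundary Omega).

Let oO : open Omega. Proof. by case: Omega_sc.1. Qed.
Let nO : Omega !=set0. Proof. by case: Omega_sc.1. Qed.
Let lip x y : d x <= d y + eucl_norm (x - y). Proof. exact: dist_boundary_lip. Qed.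

Definition energy_density (y : R * R) : R :=
  eucl_norm (grad u y) `^ q * d y `^ gamma.

Lemma energy_density_ge0 y : 0 <= energy_density y.
Proof. by rewrite mulr_ge0 ?powR_ge0. Qed.

Lemma measurable_energy_density (A : set plane) :
  measurable_fun A (energy_density : plane -> R).
Proof.
apply: measurable_funTS; apply: measurable_funM.
  apply: (@measurableT_comp _ _ _ _ _ _ (fun x : R => x `^ q)) => //.
  apply: continuous_measurable_plane => x.
  apply: (@continuous_comp _ _ _ (grad u)); last exact: continuous_eucl_norm.
  by apply: continuous_at_pair; [exact: (u_smooth [:: false]).1|exact: (u_smooth [:: true]).1].
apply: (@measurableT_comp _ _ _ _ _ _ (fun x : R => x `^ gamma)) => //.
by apply: continuous_measurable_plane; exact: continuous_dist_boundary.
Qed.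

Lemma measurable_energy (A : set plane) :
  measurable_fun A (fun y : plane => (energy_density y)%:E).
Proof. by apply/measurable_EFinP; exact: measurable_energy_density. Qed.

Definition energy (A : set (R * R)) : \bar R :=
  (\int[mu2]_(y in A) (energy_density y)%:E)%E.

Lemma le_energy (A B : set (R * R)) : measurable (A : set plane) ->
  measurable (B : set plane) -> A `<=` B -> (energy A <= energy B)%E.
Proof.
move=> mA mB AB; apply: ge0_subset_integral => //; first exact: measurable_energy.
by move=> y _; rewrite lee_fin energy_density_ge0.
Qed.

Lemma ler_partial_grad b y : `|partial b u y| <= eucl_norm (grad u y).
Proof.
by case: b; [exact: (ler_snd_eucl_norm (grad u y))|exact: (ler_fst_eucl_norm (grad u y))].
Qed.

(** Here [k] bounds the inverse of the weight and [m] the energy of the square;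
    [l] is the free level of [ler_level_powR]. *)
Lemma partial_integral_le (c : R * R) (r k m l : R) (b : bool) :
    0 < r -> 0 < l -> 0 <= k -> square c r `<=` Omega ->
    (forall y, square c r y -> d y `^ (- gamma) <= k) ->
    (energy (square c r) <= m%:E)%E ->
  (\int[mu2]_(y in square c r) `|partial b u y|%:E <=
     (4 * r ^+ 2 * l + l `^ (1 - q) * k * m)%:E)%E.
Proof.
move=> r0 l0 k0 TO Tk Tm; have mT := @measurable_square R c r.
have c0 : 0 <= l `^ (1 - q) * k by rewrite mulr_ge0 ?powR_ge0.
have mE : measurable_fun (square c r : set plane)
    (fun y : plane => (l `^ (1 - q) * k * energy_density y)%:E).
  by apply/measurable_EFinP; apply: measurable_funM => //; exact: measurable_energy_density.
apply: (@le_trans _ _ (\int[mu2]_(y in square c r)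
    (l%:E + (l `^ (1 - q) * k * energy_density y)%:E))%E).
  apply: ge0_le_integral => //.
  - apply/measurable_EFinP; apply: measurable_funTS.
    by apply: continuous_measurable_plane => z; apply: cvg_norm; exact: (u_smooth [:: b]).1.
  - by apply: emeasurable_funD.
  move=> y Ty; rewrite -EFinD lee_fin.
  apply: le_trans (ler_level_powR q_gt1 l0 (normr_ge0 _)) _.
  rewrite lerD2l -mulrA ler_wpM2l ?powR_ge0//.
  have dy : 0 < d y by apply: dist_boundary_gt0 => //; exact: TO.
  apply: (@le_trans _ _ (eucl_norm (grad u y) `^ q)).
    apply: ge0_ler_powR; rewrite ?nnegrE ?eucl_norm_ge0//; first by have := q_gt1; lra.
    exact: ler_partial_grad.
  rewrite /energy_density mulrCA ler_peMr ?powR_ge0//.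
  have := Tk y Ty; rewrite powRN => h.
  by rewrite -[leLHS](@mulVf _ (d y `^ gamma)) ?gt_eqF ?powR_gt0// ler_wpM2r// powR_ge0.
rewrite ge0_integralD//; last 2 first.
- by move=> y _; rewrite lee_fin ltW.
- by move=> y _; rewrite lee_fin mulr_ge0 ?energy_density_ge0.
rewrite [leRHS]EFinD; apply: leeD.
  apply: (@le_trans _ _ (l%:E * mu2 (square c r))%E).
    by rewrite le_eqVlt; apply/orP; left; apply/eqP; exact: integral_cst.
  by rewrite square_measure// -EFinM lee_fin mulrC.
under eq_integral do rewrite EFinM.
rewrite ge0_integralZl_EFin//.
- by rewrite (EFinM (l `^ (1 - q) * k)); apply: lee_wpmul2l => //; rewrite lee_fin.
- by move=> y _; rewrite lee_fin energy_density_ge0.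
- exact: measurable_energy.
Qed.

(** The radius leaves room, beyond the exit points at distance [5/4 * d v] at
    most, for their own clouds, and is less than the radius [2 * d v] allowed
    in the final inequality. *)
Definition cloud (v : R * R) : set (R * R) :=
  eucl_disk v (3 / 2 * d v) `&` Omega.

Lemma measurable_disk v (r : R) : measurable (eucl_disk v r `&` Omega : set plane).
Proof.
by apply: open_measurable_plane; apply: openI; [exact: open_eucl_disk|exact: oO].
Qed.

Lemma measurable_cloud v : measurable (cloud v : set plane).
Proof. exact: measurable_disk. Qed.

(** The part of the cloud which the squares of one step of the descent may
    cover; the half of [delta * d v] is lost from the chain to its squares. *)
Definition core (v : R * R) (delta : R) : set (R * R) :=
  [set y | [/\ Omega y, delta / 2 * d v <= d y & eucl_norm (y - v) < 3 / 2 * d v]].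

(** A bound for [t `^ (- gamma)] when [t] ranges from [delta / 2] to [5 / 2],
    valid for both signs of [gamma]. *)
Definition weight_bound (delta : R) : R :=
  (delta / 2) `^ (- gamma) + (5 / 2) `^ (- gamma).

Lemma weight_bound_ge0 delta : 0 <= weight_bound delta.
Proof. by rewrite addr_ge0 ?powR_ge0. Qed.

Lemma core_weight_le v delta y : Omega v -> 0 < delta -> core v delta y ->
  d y `^ (- gamma) <= weight_bound delta * d v `^ (- gamma).
Proof.
move=> Ov d0 [Oy y1 y2]; have rho0 : 0 < d v by exact: dist_boundary_gt0.
have yv := lip y v.
have -> : d y = d y / d v * d v by rewrite divfK// gt_eqF.
rewrite powRM ?divr_ge0 ?(ltW rho0)//; last by rewrite dist_boundary_ge0.
rewrite ler_wpM2r ?powR_ge0// ler_powR_itv//; first lra.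
by rewrite ler_pdivlMr// y1 ler_pdivrMr//; lra.
Qed.

(** A square of radius [3 * s] has area [36 * s ^+ 2], and [16 / delta] comes from
    squares of radius at least [delta / 16 * rho].  The factor [2] accounts for
    the two segments between good points. *)
Definition step_cost (delta : R) : R := 2 * (36 + weight_bound delta * (16 / delta)).

Lemma step_cost_ge0 delta : 0 < delta -> 0 <= step_cost delta.
Proof.
move=> d0; rewrite mulr_ge0// addr_ge0// mulr_ge0 ?weight_bound_ge0// divr_ge0//.
exact: ltW.
Qed.

Section CoreVariation.
Variables (v : R * R) (delta l : R).
Hypothesis Omega_v : Omega v.
Hypothesis delta_gt0 : 0 < delta.
Hypothesis l_gt0 : 0 < l.
Hypothesis mass_v : (energy (cloud v) <= (l `^ q * d v `^ (gamma + 2))%:E)%E.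
Local Notation rho := (d v).

Let rho_gt0 : 0 < rho. Proof. exact: dist_boundary_gt0. Qed.

Let square_in_core c (s : R) :=
  [/\ delta / 16 * rho <= s, s <= rho & square c (3 * s) `<=` core v delta].

Let partial_le c s b : square_in_core c s ->
  (\int[mu2]_(y in square c (3 * s)) `|partial b u y|%:E <=
     (l * (36 * s ^+ 2 + weight_bound delta * rho ^+ 2))%:E)%E.
Proof.
move=> [s1 s2 Tc]; have s0 : 0 < s by apply: lt_le_trans s1; rewrite mulr_gt0// divr_gt0.
have k0 : 0 <= weight_bound delta * rho `^ (- gamma).
  by rewrite mulr_ge0 ?weight_bound_ge0 ?powR_ge0.
have Tm : (energy (square c (3 * s)) <= (l `^ q * rho `^ (gamma + 2))%:E)%E.
  apply: le_trans mass_v; apply: le_energy; [exact: measurable_square|exact: measurable_cloud|].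
  by move=> y /Tc[].
have s30 : 0 < 3 * s by lra.
have TO : square c (3 * s) `<=` Omega by move=> y /Tc[].
have Tk y : square c (3 * s) y -> d y `^ (- gamma) <= weight_bound delta * rho `^ (- gamma).
  by move=> /Tc; exact: core_weight_le.
apply: le_trans (partial_integral_le b s30 l_gt0 k0 TO Tk Tm) _.
rewrite lee_fin le_eqVlt; apply/orP; left; apply/eqP.
have lE : l `^ (1 - q) * l `^ q = l.
  by rewrite -powRD_gt0// subrK powRr1// ltW.
have rE : rho `^ (- gamma) * rho `^ (gamma + 2) = rho ^+ 2.
  by rewrite -powRD_gt0// addKr powR_mulrn// ltW.
transitivity (36 * s ^+ 2 * l + weight_bound delta * (l `^ (1 - q) * l `^ q) *
    (rho `^ (- gamma) * rho `^ (gamma + 2))); first by ring.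
by rewrite lE rE; ring.
Qed.

(** A gradient of constant size [l] has at scale [rho] an energy of order
    [l `^ q * rho `^ (gamma + 2)].  Conversely, if the energy of the cloud is at
    most this, as the hypothesis [mass_v] says, then [u] varies between
    adjacent squares as if its gradient were of size [l]. *)
Lemma core_variation c c' s s' :
    [/\ delta / 16 * rho <= s, s <= rho & square c (3 * s) `<=` core v delta] ->
    [/\ delta / 16 * rho <= s', s' <= rho & square c' (3 * s') `<=` core v delta] ->
    `|c'.1 - c.1| + s' <= 3 * s -> `|c'.2 - c.2| + s <= 3 * s' ->
  `|u (good_point u_smooth c' s') - u (good_point u_smooth c s)|
    <= step_cost delta * (l * rho).
Proof.
move=> Cc Cc' h1 h2.
have W0 := weight_bound_ge0 delta.
have pos s0 : delta / 16 * rho <= s0 -> 0 < s0.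
  by apply: lt_le_trans; rewrite mulr_gt0// divr_gt0.
have k0 s0 : 0 <= l * (36 * s0 ^+ 2 + weight_bound delta * rho ^+ 2).
  by rewrite mulr_ge0 ?(ltW l_gt0)// addr_ge0// mulr_ge0 ?sqr_ge0.
have bd s0 : delta / 16 * rho <= s0 -> s0 <= rho ->
    l * (36 * s0 ^+ 2 + weight_bound delta * rho ^+ 2) / s0 <=
    (36 + weight_bound delta * (16 / delta)) * (l * rho).
  move=> s1 s2; have s00 := pos _ s1; rewrite ler_pdivrMr//.
  have -> : (36 + weight_bound delta * (16 / delta)) * (l * rho) * s0 =
    l * ((36 + weight_bound delta * (16 / delta)) * (rho * s0)) by ring.
  rewrite ler_pM2l//.
  have e1 : 36 * s0 ^+ 2 <= 36 * (rho * s0) by rewrite ler_pM2l// expr2 ler_pM2r.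
  have e2 : weight_bound delta * rho ^+ 2 <= weight_bound delta * (16 / delta * (rho * s0)).
    rewrite ler_wpM2l// -[leLHS](_ : 16 / delta * (rho * (delta / 16 * rho)) = _); last first.
      by field; rewrite gt_eqF.
    by rewrite ler_pM2l ?divr_gt0// ler_pM2l.
  by apply: le_trans (lerD e1 e2) _; rewrite [leRHS]mulrDl -(mulrA (weight_bound delta)).
have [s1 s2 _] := Cc; have [s1' s2' _] := Cc'.
have := good_point_variation u_smooth (pos _ s1) (pos _ s1') (k0 s) (k0 s') h1 h2
  (partial_le false Cc) (partial_le true Cc').
move=> /le_trans; apply.
apply: le_trans (lerD (bd _ s1 s2) (bd _ s1' s2')) _.
by rewrite /step_cost -mulrA [in leRHS]mulr_natl mulr2n.
Qed.

Section Step.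
Variables (m N L : nat).
Hypothesis delta_def : delta = 2^-1 ^+ m.
Hypothesis delta_le : delta <= 1 / 8.
Hypothesis N_gt0 : (0 < N)%N.
Hypothesis N_le : N%:R * (16 * delta) <= 1.
Hypothesis L_ge : 20 <= L%:R * delta.

Let U c s := u (good_point u_smooth c s).

Let sup_square c (r : R) (y : R * R) : square c r y -> eucl_norm (y - c) <= 2 * r.
Proof.
move=> /squareP[y1 y2]; apply: le_trans (eucl_norm_le_sum _) _ => /=; lra.
Qed.

Let halving (j : nat) : (j <= m)%N ->
  `|U v (rho / 16 * 2^-1 ^+ j) - U v (rho / 16)| <= j%:R * (step_cost delta * (l * rho)).
Proof.
have rho0 := rho_gt0; have dl := delta_le.
have Cj i : (i <= m)%N -> [/\ delta / 16 * rho <= rho / 16 * 2^-1 ^+ i,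
    rho / 16 * 2^-1 ^+ i <= rho & square v (3 * (rho / 16 * 2^-1 ^+ i)) `<=` core v delta].
  move=> im; have h1 : 2^-1 ^+ i <= 1 :> R by rewrite exprn_ile1//; lra.
  have h2 : delta <= 2^-1 ^+ i by rewrite delta_def ler_wiXn2l//; lra.
  have h3 : rho / 16 * 2^-1 ^+ i <= rho / 16 by rewrite ler_piMr//; lra.
  split.
  - have -> : delta / 16 * rho = rho / 16 * delta by ring.
    by rewrite ler_pM2l//; lra.
  - lra.
  move=> y /sup_square yv; have := lip v y; rewrite eucl_distC => vy.
  split; [apply: near_Omega Omega_v _ => //; lra| |lra].
  have : delta / 2 * rho <= rho / 16 by rewrite mulrC ler_pM2l//; lra.
  lra.
elim: j => [|j IH] jm; first by rewrite expr0 mulr1 subrr normr0 mul0r.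
rewrite -(natr1 j) [leRHS]mulrDl mul1r.
have E0 : 0 <= rho / 16 * 2^-1 ^+ j by rewrite mulr_ge0 ?exprn_ge0//; lra.
have e : rho / 16 * 2^-1 ^+ j.+1 = rho / 16 * 2^-1 ^+ j / 2 by rewrite exprSr mulrA.
have := core_variation (Cj j (ltnW jm)) (Cj j.+1 jm).
rewrite !subrr !normr0 e => H.
have := IH (ltnW jm).
have {H} : `|U v (rho / 16 * 2^-1 ^+ j / 2) - U v (rho / 16 * 2^-1 ^+ j)| <=
    step_cost delta * (l * rho) by apply: H; lra.
by move: (U _ _) (U _ _) (U _ _) => a b c; rewrite !ler_norml; lra.
Qed.

(** The squares are first halved [m] times around [v], down to the scale
    [delta * rho / 16], then moved along a chain to the exit point [v'].  As
    [d v' = delta * rho], their final scale is [d v' / 16], with which the next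
    step starts.  The bound on [L] lets the chain fit into the grid of
    [chained_variation]. *)
Lemma descent_step : exists v', [/\ Omega v', d v' = delta * rho,
    (N%:R%:E * energy (cloud v') <= energy (cloud v))%E &
    `|u (good_point u_smooth v' (d v' / 16)) - u (good_point u_smooth v (rho / 16))| <=
    (m + (L.*2.+1 * L.*2.+1 + 2))%:R * (step_cost delta * (l * rho))].
Proof.
have rho0 := rho_gt0; have dl := delta_le.
have dr0 : 0 < delta * rho by exact: mulr_gt0.
have dr8 : delta * rho <= rho / 8.
  have : delta * rho <= 1 / 8 * rho by rewrite ler_pM2r.
  lra.
pose s := delta * rho / 16; have s0 : 0 < s by rewrite divr_gt0.
have [y [yreach ysep]] := separated_exit_points Omega_sc Omega_proper Omega_v delta_gt0
  delta_le s0 N_le.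
have ycloud i : (i < N)%N -> cloud (y i) `<=` cloud v.
  move=> /yreach[/chained_mem[_ _ yv] dy] z [zy Oz].
  rewrite /eucl_disk /= dy in zy; split => //.
  by have := ler_eucl_distD (y i) z v; rewrite /eucl_disk /=; lra.
have ydisj i j : (i < j < N)%N -> cloud (y i) `&` cloud (y j) = set0.
  move=> ijN; have /andP[ij jN] := ijN; rewrite -subset0 => z [[zi _] [zj _]].
  rewrite /eucl_disk /= in zi zj.
  have := ysep i j ijN; have := ler_eucl_distD z (y j) (y i).
  have [_ di] := yreach i (ltn_trans ij jN); have [_ dj] := yreach j jN.
  by rewrite (eucl_distC (y j) z); rewrite di in zi; rewrite dj in zj; lra.
have [i iN massi] : exists2 i, (i < N)%N &
    (N%:R%:E * energy (cloud (y i)) <= energy (cloud v))%E.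
  apply: (@integral_pigeonhole _ plane R mu2 N (fun i => cloud (y i)) (cloud v)
    (fun z => (energy_density z)%:E) N_gt0 _ _ _ _ ycloud ydisj).
  - by move=> i; exact: measurable_cloud.
  - exact: measurable_cloud.
  - exact: measurable_energy.
  - by move=> z; rewrite lee_fin energy_density_ge0.
have [yr dy] := yreach i iN.
exists (y i); split => //; first by have [] := chained_mem yr.
rewrite dy natrD mulrDl.
have sE : rho / 16 * 2^-1 ^+ m = s by rewrite -delta_def /s; ring.
have h1 := halving (leqnn m); rewrite sE in h1.
have bounded z : deep Omega v delta z -> eucl_norm (z - v) <= L%:R * s.
  move=> [_ _ zv]; apply: le_trans zv _.
  have -> : L%:R * s = L%:R * delta * (rho / 16) by rewrite /s; ring.
  have : 20 * (rho / 16) <= L%:R * delta * (rho / 16) by rewrite ler_pM2r// divr_gt0.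
  lra.
have sc c z : deep Omega v delta z -> `|z.1 - c.1| <= s -> `|z.2 - c.2| <= s ->
    [/\ delta / 16 * rho <= s, s <= rho & square c (3 * s) `<=` core v delta].
  move=> [Oz dz zv] z1 z2; split; [rewrite /s mulrAC//|rewrite /s; lra|].
  move=> w /sup_square wc.
  have zc : eucl_norm (z - c) <= 2 * s.
    by apply: le_trans (eucl_norm_le_sum _) _ => /=; lra.
  have wz := ler_eucl_distD c w z; rewrite (eucl_distC c z) in wz.
  have lz := lip z w; rewrite (eucl_distC z w) in lz.
  have lv := ler_eucl_distD z w v.
  rewrite /s in wc zc; split; [apply: near_Omega Oz _ => //; lra| |lra].
  have -> : delta / 2 * rho = delta * rho / 2 by ring.
  lra.
have h2 := @chained_variation R (deep Omega v delta) s v L s0 bounded (fun c => U c s)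
  (step_cost delta * (l * rho)) (y i).
have {}h2 : `|U (y i) s - U v s| <=
    (L.*2.+1 * L.*2.+1 + 2)%:R * (step_cost delta * (l * rho)).
  apply: h2 => // c c' z z' Oz Oz' z1 z2 z1' z2' c1 c2.
  by apply: core_variation; [exact: sc Oz z1 z2|exact: sc Oz' z1' z2'|lra|lra].
move: h1 h2; rewrite -/(U (y i) _) -/(U v (rho / 16)) -/s.
by move: (U _ _) (U _ _) (U _ _) => a b c; rewrite !ler_norml; lra.
Qed.

End Step.

End CoreVariation.

Section Descent.
Variables (delta : R) (m N L : nat) (eps : R).
Hypothesis delta_def : delta = 2^-1 ^+ m.
Hypothesis delta_le : delta <= 1 / 8.
Hypothesis N_gt0 : (0 < N)%N.
Hypothesis N_le : N%:R * (16 * delta) <= 1.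
Hypothesis L_ge : 20 <= L%:R * delta.

(** The factor by which the gradient size [l] of [core_variation] grows in a
    step: the energy is divided by [N], and [rho] multiplied by [delta]. *)
Let tau : R := (delta `^ (- (gamma + 2)) / N%:R) `^ q^-1.

Definition descent_ratio : R := delta * tau.

(** [m] halvings, the moves between the cells of a grid of [L.*2.+1 ^ 2] cells,
    and the moves to the grid from [v] and from the grid to [v']. *)
Definition descent_cost : R := (m + (L.*2.+1 * L.*2.+1 + 2))%:R * step_cost delta.

Hypothesis ratio_lt1 : descent_ratio < 1.
Hypothesis eps_gt0 : 0 < eps.
Hypothesis u_vanish : forall y, Omega y -> d y < eps -> u y = 0.

Let delta_gt0 : 0 < delta. Proof. by rewrite delta_def exprn_gt0. Qed.

Let U c s := u (good_point u_smooth c s).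

Let tau_gt0 : 0 < tau.
Proof. by rewrite powR_gt0// divr_gt0 ?powR_gt0// ltr0n. Qed.

Let tauq : tau `^ q * delta `^ (gamma + 2) * N%:R = 1.
Proof.
have q0 : q != 0 by rewrite gt_eqF// (lt_trans ltr01 q_gt1).
have N0 : (N%:R : R) != 0 by rewrite pnatr_eq0 -lt0n.
rewrite /tau -powRrM mulVf// powRr1; last by rewrite divr_ge0 ?powR_ge0.
by rewrite powRN; field; rewrite N0 gt_eqF// powR_gt0.
Qed.

Let ratio_gt0 : 0 < descent_ratio. Proof. exact: mulr_gt0. Qed.

(** The size [l] of the gradient is multiplied by [tau] and the scale by [delta]
    at each step, so that the increments of [u] form a geometric series of
    ratio [delta * tau]. *)
Let descent_iter v (l : R) (K : nat) : Omega v -> 0 < l ->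
    (energy (cloud v) <= (l `^ q * d v `^ (gamma + 2))%:E)%E ->
  exists v', [/\ Omega v', d v' = delta ^+ K * d v,
    (energy (cloud v') <= ((tau ^+ K * l) `^ q * d v' `^ (gamma + 2))%:E)%E &
    `|U v' (d v' / 16) - U v (d v / 16)| <=
      descent_cost * (l * d v) * ((1 - descent_ratio ^+ K) / (1 - descent_ratio))].
Proof.
move=> Ov l0 mass; elim: K => [|K [w [Ow dw massw Uw]]].
  by exists v; rewrite !expr0 !mul1r !subrr normr0 mul0r mulr0.
have tl0 : 0 < tau ^+ K * l by rewrite mulr_gt0// exprn_gt0.
have [w' [Ow' dw' massw' Uw']] :=
  descent_step Ow delta_gt0 tl0 massw delta_def delta_le N_gt0 N_le L_ge.
have w0 : 0 < d w by exact: dist_boundary_gt0.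
exists w'; split; first exact: Ow'.
- by rewrite dw' dw exprS mulrA.
- have N0 : (0 < N%:R%:E :> \bar R)%E by rewrite lte_fin ltr0n.
  rewrite -(lee_pmul2l _ N0); last exact: fin_numE.
  apply: le_trans massw' _.
  apply: le_trans massw _; rewrite -EFinM lee_fin dw' le_eqVlt; apply/orP; left; apply/eqP.
  rewrite exprS -mulrA (powRM _ (ltW tau_gt0) (ltW tl0)) (powRM _ (ltW delta_gt0) (ltW w0)).
  move: tauq; move: (tau `^ q) (delta `^ _) (_ `^ q) (d w `^ _) (N%:R : R) => a b c e n abn.
  by rewrite -[LHS]mul1r -abn; ring.
have E : descent_cost * (tau ^+ K * l * d w) = descent_cost * (l * d v) * descent_ratio ^+ K.
  by rewrite dw /descent_ratio exprMn; ring.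
have r1 : 1 - descent_ratio != 0 by rewrite gt_eqF// subr_gt0.
have -> : (1 - descent_ratio ^+ K.+1) / (1 - descent_ratio) =
    (1 - descent_ratio ^+ K) / (1 - descent_ratio) + descent_ratio ^+ K.
  by rewrite exprS; field.
rewrite mulrA in Uw'; rewrite E in Uw'.
rewrite mulrDr; move: Uw Uw'; rewrite -!/(U _ _).
move: (U _ _) (U _ _) (U _ _) (_ * (_ / _)) (_ * (_ ^+ K)) => a b c e f.
by rewrite !ler_norml; lra.
Qed.

Lemma good_point_dist v : Omega v ->
  Omega (good_point u_smooth v (d v / 16)) /\
  d (good_point u_smooth v (d v / 16)) <= 2 * d v.
Proof.
move=> Ov; have rho0 : 0 < d v by exact: dist_boundary_gt0.
have s0 : 0 < d v / 16 by lra.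
have [z1 z2] := good_point_near u_smooth v s0.
move: (good_point _ _ _) z1 z2 => z z1 z2.
have zv : eucl_norm (z - v) <= d v / 8.
  by apply: le_trans (eucl_norm_le_sum _) _ => /=; lra.
split; first by apply: near_Omega Ov _ => //; lra.
by have := lip z v; lra.
Qed.

(** Since the support of [u] is compact, [u] vanishes after enough steps. *)
Lemma descent_bound v (l : R) : Omega v -> 0 < l ->
    (energy (cloud v) <= (l `^ q * d v `^ (gamma + 2))%:E)%E ->
  `|U v (d v / 16)| <= descent_cost / (1 - descent_ratio) * (l * d v).
Proof.
move=> Ov l0 mass; have rho0 : 0 < d v by exact: dist_boundary_gt0.
have dl := delta_le; have dl0 := delta_gt0; have e0 := eps_gt0.
have [K Kd] : exists K : nat, delta ^+ K < eps / (2 * d v).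
  have /cvgrPdist_lt/(_ (eps / (2 * d v))) : (fun n => delta ^+ n) @ \oo --> (0 : R).
    by apply: cvg_expr; rewrite gtr0_norm//; lra.
  have -> : 0 < eps / (2 * d v) by rewrite divr_gt0// mulr_gt0.
  move=> /(_ isT)[K _ /(_ K (leqnn K))]; rewrite sub0r normrN.
  by rewrite gtr0_norm ?exprn_gt0// => h; exists K.
have [w [Ow dw _ Uw]] := descent_iter K Ov l0 mass.
have [Oz dz] := good_point_dist Ow.
have U0 : U w (d w / 16) = 0.
  apply: u_vanish => //; apply: le_lt_trans dz _.
  by move: Kd; rewrite dw ltr_pdivlMr ?mulr_gt0//; lra.
rewrite U0 sub0r normrN in Uw; apply: le_trans Uw _.
have r1 : 0 < 1 - descent_ratio by rewrite subr_gt0.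
have C0 : 0 <= descent_cost by rewrite mulr_ge0// step_cost_ge0.
have -> : descent_cost * (l * d v) * ((1 - descent_ratio ^+ K) / (1 - descent_ratio)) =
    descent_cost / (1 - descent_ratio) * (l * d v) * (1 - descent_ratio ^+ K) by ring.
rewrite ler_piMr//.
  by rewrite mulr_ge0 ?divr_ge0 ?(ltW r1)// mulr_ge0 ?(ltW l0) ?(ltW rho0).
by have := exprn_ge0 K (ltW ratio_gt0); lra.
Qed.

End Descent.

Section Start.
Variables (x : R * R) (a delta : R).
Hypothesis Omega_x : Omega x.
Hypothesis a_gt0 : 0 < a.
Hypothesis delta_gt0 : 0 < delta.
Hypothesis delta_le : delta <= 1 / 8.
Hypothesis disk_energy : forall r : R, 0 < r < 2 * d x ->
  (energy (eucl_disk x r `&` Omega) <= (a `^ q * (4 * r ^+ 2))%:E)%E.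
Local Notation rho := (d x).

Let rho_gt0 : 0 < rho. Proof. exact: dist_boundary_gt0. Qed.

(** The size of a gradient whose weighted [q]-mean at scale [rho] is [a]. *)
Let l : R := a * rho `^ (- (gamma / q)).

Let l_gt0 : 0 < l. Proof. by rewrite mulr_gt0 ?powR_gt0. Qed.



Let lq : l `^ q = a `^ q * rho `^ (- gamma).
Proof.
by rewrite /l powRM ?powR_ge0 ?(ltW a_gt0)// -powRrM mulNr divfK// gt_eqF// (lt_trans ltr01 q_gt1).
Qed.

(** A square of radius [3 * s], of area [36 * s ^+ 2], is contained in a disk of
    radius [7 * s], of area less than [196 * s ^+ 2]. *)
Definition start_cost : R := 36 + 196 * weight_bound delta.

Let s_ (j : nat) : R := rho / 16 * 2^-1 ^+ j.

Let s_gt0 j : 0 < s_ j.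
Proof. by rewrite mulr_gt0 ?exprn_gt0// divr_gt0. Qed.

Let s_le j : s_ j <= rho / 16.
Proof.
by rewrite ler_piMr// ?exprn_ile1//; have := rho_gt0; lra.
Qed.

Let s_S j : s_ j.+1 = s_ j / 2. Proof. by rewrite /s_ exprSr mulrA. Qed.

Let square_start j : square x (3 * s_ j) `<=` core x delta `&` eucl_disk x (7 * s_ j).
Proof.
move=> y /squareP[y1 y2]; have r0 := rho_gt0; have s0 := s_gt0 j; have sl := s_le j.
have dl := delta_le.
have yx : eucl_norm (y - x) <= 6 * s_ j.
  by apply: le_trans (eucl_norm_le_sum _) _ => /=; lra.
have := lip x y; rewrite eucl_distC => xy.
have dr : delta / 2 * rho <= rho / 16.
  by have : delta / 2 * rho <= 1 / 16 * rho by [rewrite ler_pM2r//; lra|]; lra.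
split; last by rewrite /eucl_disk /=; lra.
by split; [apply: near_Omega Omega_x _ => //; lra|lra|lra].
Qed.

Let partial_start j b :
  (\int[mu2]_(y in square x (3 * s_ j)) `|partial b u y|%:E <=
     (l * s_ j ^+ 2 * start_cost)%:E)%E.
Proof.
have r0 := rho_gt0; have s0 := s_gt0 j; have sl := s_le j.
have k0 : 0 <= weight_bound delta * rho `^ (- gamma).
  by rewrite mulr_ge0 ?weight_bound_ge0 ?powR_ge0.
have Tm : (energy (square x (3 * s_ j)) <= (a `^ q * (4 * (7 * s_ j) ^+ 2))%:E)%E.
  have r7 : 0 < 7 * s_ j < 2 * rho by lra.
  apply: le_trans (disk_energy r7); apply: le_energy;
    [exact: measurable_square|exact: measurable_disk|].
  by move=> y /square_start[[]].
have s30 : 0 < 3 * s_ j by lra.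
have TO : square x (3 * s_ j) `<=` Omega by move=> y /square_start[[]].
have Tk y : square x (3 * s_ j) y -> d y `^ (- gamma) <= weight_bound delta * rho `^ (- gamma).
  by move=> /square_start[? _]; exact: core_weight_le.
apply: le_trans (partial_integral_le b s30 l_gt0 k0 TO Tk Tm) _.
rewrite lee_fin le_eqVlt; apply/orP; left; apply/eqP.
have lE : l `^ (1 - q) * (a `^ q * rho `^ (- gamma)) = l.
  by rewrite -lq -powRD_gt0// subrK powRr1// ltW.
transitivity (36 * s_ j ^+ 2 * l + 196 * weight_bound delta * s_ j ^+ 2 *
  (l `^ (1 - q) * (a `^ q * rho `^ (- gamma)))); first by ring.
by rewrite lE /start_cost; ring.
Qed.

Let start_cost_ge0 : 0 <= start_cost.
Proof. by rewrite addr_ge0 ?ler0n// mulr_ge0 ?ler0n ?weight_bound_ge0. Qed.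

Let U c s := u (good_point u_smooth c s).

Let start_iter j : `|U x (s_ j) - U x (rho / 16)| <=
  l * start_cost * (rho / 4) * (1 - 2^-1 ^+ j).
Proof.
elim: j => [|j IH].
  by rewrite /s_ !expr0 mulr1 !subrr normr0 mulr0.
have r0 := rho_gt0; have s0 := s_gt0 j; have c0 := start_cost_ge0; have l0 := l_gt0.
have k0 i : 0 <= l * s_ i ^+ 2 * start_cost.
  by rewrite mulr_ge0// mulr_ge0 ?sqr_ge0// ltW.
have := good_point_variation u_smooth (s_gt0 j) (s_gt0 j.+1) (k0 j) (k0 j.+1).
move=> /(_ x x); rewrite !subrr !normr0 !add0r => H.
have {}H : `|U x (s_ j.+1) - U x (s_ j)| <=
    l * s_ j ^+ 2 * start_cost / s_ j + l * s_ j.+1 ^+ 2 * start_cost / s_ j.+1.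
  by apply: H; [rewrite s_S; lra|rewrite s_S; lra|exact: partial_start|exact: partial_start].
have E i : l * s_ i ^+ 2 * start_cost / s_ i = l * start_cost * s_ i.
  by field; rewrite gt_eqF.
rewrite !E s_S in H.
have lc0 : 0 <= l * start_cost by rewrite mulr_ge0// ltW.
have {}H : `|U x (s_ j.+1) - U x (s_ j)| <= l * start_cost * (2 * s_ j).
  by rewrite s_S; apply: le_trans H _; rewrite -mulrDr ler_wpM2l//; lra.
have -> : l * start_cost * (rho / 4) * (1 - 2^-1 ^+ j.+1) =
    l * start_cost * (rho / 4) * (1 - 2^-1 ^+ j) + l * start_cost * (2 * s_ j).
  by rewrite /s_ exprS; field.
move: IH H; move: (U _ _) (U _ _) (U _ _) (_ * (1 - _)) (_ * (2 * _)) => A B C D F.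
by rewrite !ler_norml; lra.
Qed.

(** The increments over the dyadic squares around [x] are summable because the
    averages over all small disks are bounded by the same [a]; the good points
    converge to [x]. *)
Lemma start_bound : `|u x - U x (rho / 16)| <= l * start_cost * (rho / 4).
Proof.
apply/ler_addgt0Pr => e e0.
have cu : continuous u by exact: (u_smooth [::]).1.
have /cu/nearE_eucl[h h0 hu] : nbhs (u x) [set t | `|u x - t| < e].
  by have := @cvgrPdist_lt _ _ _ (nbhs (u x)) _ id (u x); case=> /(_ (@cvg_id _ _))/(_ e e0).
have [j jh] : exists j, 2 * s_ j < h.
  have /cvgrPdist_lt/(_ (h / rho)) : (fun n => 2^-1 ^+ n) @ \oo --> (0 : R).
    by apply: cvg_expr; rewrite gtr0_norm//; lra.
  have -> : 0 < h / rho by rewrite divr_gt0.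
  move=> /(_ isT)[K _ /(_ K (leqnn K))]; rewrite sub0r normrN.
  rewrite gtr0_norm ?exprn_gt0// ltr_pdivlMr// => hK; exists K.
  have -> : 2 * s_ K = 2^-1 ^+ K * rho / 8 by rewrite /s_; field.
  by have : 0 < 2^-1 ^+ K * rho by [rewrite mulr_gt0// exprn_gt0|]; lra.
have s0 := s_gt0 j.
have [z1 z2] := good_point_near u_smooth x s0.
have {}hu : `|u x - U x (s_ j)| < e.
  apply: hu; apply: le_lt_trans (eucl_norm_le_sum _) _ => /=.
  by move: z1 z2 jh; rewrite -/(good_point _ _); lra.
have := start_iter j.
have c0 : 0 <= l * start_cost * (rho / 4).
  by rewrite mulr_ge0 ?divr_ge0 ?(ltW rho_gt0)// mulr_ge0// ltW.
have : l * start_cost * (rho / 4) * (1 - 2^-1 ^+ j) <= l * start_cost * (rho / 4).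
  by rewrite ler_piMr// gerBl exprn_ge0.
by move: hu; rewrite ltr_norml !ler_norml; lra.
Qed.

(** The energy of the cloud of [x] makes the descent start with a gradient of
    size [9 * l]: the disk of radius [3/2 * rho] has an area less than
    [9 * rho ^+ 2], and [9 <= 9 `^ q]. *)
Lemma start_energy :
  (energy (cloud x) <= ((9 * l) `^ q * rho `^ (gamma + 2))%:E)%E.
Proof.
have r0 := rho_gt0.
have r32 : 0 < 3 / 2 * rho < 2 * rho by lra.
apply: (@le_trans _ _ (a `^ q * (4 * (3 / 2 * rho) ^+ 2))%:E).
  apply: le_trans (disk_energy r32); apply: le_energy;
    [exact: measurable_cloud|exact: measurable_disk|].
  by move=> y [].
rewrite lee_fin powRM ?(ltW l_gt0)// lq powRD_gt0// powR_mulrn ?(ltW r0)//.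
have -> : 9 `^ q * (a `^ q * rho `^ (- gamma)) * (rho `^ gamma * rho ^+ 2) =
    9 `^ q * (a `^ q * rho ^+ 2) * (rho `^ (- gamma) * rho `^ gamma) by ring.
rewrite -powRD_gt0// addNr powRr0 mulr1.
have -> : a `^ q * (4 * (3 / 2 * rho) ^+ 2) = 9 * (a `^ q * rho ^+ 2) by field.
rewrite ler_wpM2r//; first by apply: mulr_ge0; [exact: powR_ge0|exact: sqr_ge0].
by apply: le1r_powR; rewrite ?(ltW q_gt1)//; lra.
Qed.

End Start.

End Energy.

(** * The pointwise inequality *)

Section PointwiseInequality.
Context {R : realType}.
Local Notation plane := (measurableTypeR R * measurableTypeR R)%type.
Local Notation mu2 := (@lebesgue2 R).

(** On the compact support of [u], the distance to the boundary has a positive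
    minimum. *)
Lemma test_function_vanish (Omega : set (R * R)) (u : R * R -> R) :
    simply_connected_domain Omega -> Omega `<` [set: R * R] -> test_function Omega u ->
  exists2 eps : R, 0 < eps &
    forall y, Omega y -> dist_boundary Omega y < eps -> u y = 0.
Proof.
move=> [[oO _ nO] _] pO [_ cS SO]; pose S := closure [set x | u x != 0].
have uS y : ~ S y -> u y = 0.
  by move=> Sy; apply/eqP; apply: contra_notT Sy => uy; exact: subset_closure.
have [S0|] := pselect (S !=set0); last first.
  by move=> S0; exists 1 => // y _ _; apply: uS => Sy; apply: S0; exists y.
have cd : {within S, continuous (dist_boundary Omega)}.
  exact/continuous_subspaceT/continuous_dist_boundary.
have [c /[!inE] Sc cmin] := compact_EVT_min S0 cS cd.
exists (dist_boundary Omega c); first by apply: dist_boundary_gt0 => //; exact: SO.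
move=> y _ yc; apply: uS => Sy; have := cmin y; rewrite inE => /(_ Sy).
by rewrite leNgt yc.
Qed.

Definition hardy_constant (q gamma delta : R) (m N L : nat) : R :=
  start_cost gamma delta / 4 +
  9 * (descent_cost gamma delta m L / (1 - descent_ratio q gamma delta N)).

Lemma hardy_of_disk_energy (Omega : set (R * R)) (u : R * R -> R) (q gamma delta a : R)
    (m N L : nat) (x : R * R) :
    simply_connected_domain Omega -> Omega `<` [set: R * R] -> test_function Omega u ->
    1 < q -> delta = 2^-1 ^+ m -> delta <= 1 / 8 -> (0 < N)%N ->
    N%:R * (16 * delta) <= 1 -> 20 <= L%:R * delta ->
    descent_ratio q gamma delta N < 1 -> Omega x -> 0 < a ->
    (forall r : R, 0 < r < 2 * dist_boundary Omega x ->
       (energy Omega u q gamma (eucl_disk x r `&` Omega) <= (a `^ q * (4 * r ^+ 2))%:E)%E) ->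
  `|u x| <= hardy_constant q gamma delta m N L *
    (a * dist_boundary Omega x `^ (1 - gamma / q)).
Proof.
move=> sc pO tu q1 dE d8 N0 N16 L20 ratio1 Ox a0 disk.
have us : smooth u by case: tu.
have [eps eps0 van] := test_function_vanish sc pO tu.
have d0 : 0 < delta by rewrite dE exprn_gt0.
have [[oO _ nO] _] := sc.
have rho0 : 0 < dist_boundary Omega x by exact: dist_boundary_gt0.
pose l := a * dist_boundary Omega x `^ (- (gamma / q)).
have l0 : 0 < l by rewrite mulr_gt0 ?powR_gt0.
have st : `|u x - u (good_point us x (dist_boundary Omega x / 16))| <=
   l * start_cost gamma delta * (dist_boundary Omega x / 4).
  exact: (start_bound sc pO us q1 Ox a0 d0 d8 disk).
have en := start_energy sc pO us q1 Ox a0 disk.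
have l90 : 0 < 9 * l by rewrite mulr_gt0.
have de := descent_bound sc pO us q1 dE d8 N0 N16 L20 ratio1 eps0 van Ox l90 en.
have rE : l * dist_boundary Omega x = a * dist_boundary Omega x `^ (1 - gamma / q).
  have -> : 1 - gamma / q = - (gamma / q) + 1 by rewrite addrC.
  by rewrite powRD_gt0// powRr1 ?(ltW rho0)// mulrA.
rewrite -rE /hardy_constant.
set C1 := descent_cost _ _ _ _ / _ in de *.
have -> : (start_cost gamma delta / 4 + 9 * C1) * (l * dist_boundary Omega x) =
   l * start_cost gamma delta * (dist_boundary Omega x / 4) +
   C1 * (9 * l * dist_boundary Omega x) by field.
move: st de; rewrite !ler_norml; lra.
Qed.

Lemma disk_measure (Omega : set (R * R)) (x : R * R) (r : R) :
    open Omega -> Omega x -> 0 < r ->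
  exists2 M : R, 0 < M <= 4 * r ^+ 2 & mu2 (eucl_disk x r `&` Omega) = M%:E.
Proof.
move=> oO Ox r0.
have oD : open (eucl_disk x r `&` Omega) by apply: openI => //; exact: open_eucl_disk.
have mD := open_measurable_plane oD.
have Dx : (eucl_disk x r `&` Omega) x.
  by split => //; rewrite /eucl_disk /= subrr eucl_norm0.
have /nearE_eucl[e e0 eD] : nbhs x (eucl_disk x r `&` Omega) by exact: open_nbhs_nbhs.
have e3 : 0 < e / 3 by lra.
have lo : (mu2 (square x (e / 3)) <= mu2 (eucl_disk x r `&` Omega))%E.
  apply: le_measure; rewrite ?inE//; first exact: measurable_square.
  move=> y /squareP[y1 y2]; apply: eD.
  by apply: le_lt_trans (eucl_norm_le_sum _) _ => /=; lra.
have hi : (mu2 (eucl_disk x r `&` Omega) <= mu2 (square x r))%E.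
  apply: le_measure; rewrite ?inE//; first exact: measurable_square.
  move=> y [yx _]; apply/squareP; split; apply/ltW.
    exact: le_lt_trans (ler_fst_eucl_norm (y - x)) yx.
  exact: le_lt_trans (ler_snd_eucl_norm (y - x)) yx.
rewrite square_measure// in lo; rewrite square_measure// in hi.
move: lo hi; case: (mu2 _) => [M| |]; rewrite ?lee_fin// => lo hi; exists M => //.
rewrite hi andbT; apply: lt_le_trans lo.
by rewrite mulr_gt0// exprn_gt0.
Qed.

(** The disk is contained in a square of area [4 * r ^+ 2]. *)
Lemma energy_le_average (Omega : set (R * R)) (u : R * R -> R) (q gamma a : R)
    (x : R * R) (r : R) :
    open Omega -> Omega x -> 0 < q -> 0 < r -> 0 < a ->
    (average (eucl_disk x r `&` Omega)
       (fun y => (energy_density Omega u q gamma y)%:E) `^ q^-1 <= a%:E)%E ->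
  (energy Omega u q gamma (eucl_disk x r `&` Omega) <= (a `^ q * (4 * r ^+ 2))%:E)%E.
Proof.
move=> oO Ox q0 r0 a0; rewrite /average.
have [M /andP[M0 M4] ->] := disk_measure oO Ox r0.
rewrite -/(energy Omega u q gamma _).
have E0 : (0 <= energy Omega u q gamma (eucl_disk x r `&` Omega))%E.
  by apply: integral_ge0 => y _; rewrite lee_fin energy_density_ge0.
move: (energy _ _ _ _ _) E0 => E E0.
rewrite inver gt_eqF// => H.
have X0 : (0 <= M^-1%:E * E)%E by rewrite mule_ge0// lee_fin invr_ge0 ltW.
have {H} : (M^-1%:E * E <= (a `^ q)%:E)%E.
  rewrite -[leLHS]poweRe1// -(@mulVf _ q) ?gt_eqF// poweRrM -poweR_EFin.
  apply: gt0_ler_poweR; rewrite ?in_itv /= ?leey ?andbT ?(ltW q0)//.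
    exact: poweR_ge0.
  by rewrite lee_fin ltW.
rewrite lee_pdivrMl// -EFinM => /le_trans; apply.
by rewrite lee_fin mulrC ler_wpM2l// powR_ge0.
Qed.

(** With [delta = 2 ^ - (m + 5)] and [N = 2 ^ (m + 1)] one has
    [16 * N * delta = 1], the largest [N] which [separated_exit_points] allows.
    Then the [q]-th power of the ratio is [16 * delta ^ (q - 1 - gamma)]. *)
Lemma descent_ratio_lt1 (q gamma : R) : 1 < q -> gamma < q - 1 ->
  exists m, descent_ratio q gamma (2^-1 ^+ (m + 5)) (2 ^ m.+1) < 1.
Proof.
move=> q1 gq; pose eta := q - 1 - gamma; have eta0 : 0 < eta by rewrite /eta; lra.
have q0 : q != 0 by rewrite gt_eqF//; lra.
have h0 : 0 < 2^-1 :> R by rewrite invr_gt0.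
have t1 : 2^-1 `^ eta < 1 :> R.
  rewrite -[ltRHS](_ : 1 `^ eta = 1); last by rewrite powR1.
  by apply: gt0_ltr_powR; rewrite ?nnegrE//; lra.
have [m mlt] : exists m : nat, (2^-1 `^ eta) ^+ m < 16^-1 :> R.
  have /cvgrPdist_lt/(_ 16^-1) : (fun n => (2^-1 `^ eta) ^+ n) @ \oo --> (0 : R).
    by apply: cvg_expr; rewrite ger0_norm ?powR_ge0.
  have -> : 0 < 16^-1 :> R by rewrite invr_gt0.
  move=> /(_ isT)[m _ /(_ m (leqnn m))]; rewrite sub0r normrN => h.
  by exists m; apply: le_lt_trans h; exact: ler_norm.
exists m; rewrite /descent_ratio; set delta := 2^-1 ^+ (m + 5).
have delta0 : 0 < delta by rewrite exprn_gt0.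
have dE : delta `^ eta <= (2^-1 `^ eta) ^+ m.
  rewrite -(powR_mulrn m (powR_ge0 _ eta)) powRAC powR_mulrn ?(ltW h0)//.
  apply: ge0_ler_powR; rewrite ?nnegrE ?exprn_ge0 ?(ltW eta0)//.
  by rewrite ler_wiXn2l ?(ltW h0) ?leq_addr//; lra.
have N16 : (2 ^ m.+1)%:R^-1 = 16 * delta :> R.
  rewrite /delta natrX exprVn exprD exprS; field.
  by rewrite expf_neq0.
have -> : delta * (delta `^ (- (gamma + 2)) / (2 ^ m.+1)%:R) `^ q^-1 =
    (16 * delta `^ eta) `^ q^-1.
  have dq : delta = (delta `^ q) `^ q^-1 by rewrite -powRrM mulfV// powRr1// ltW.
  rewrite {1}dq -powRM ?powR_ge0//; last by rewrite divr_ge0 ?powR_ge0.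
  congr (_ `^ _); rewrite N16 (_ : eta = q + (- (gamma + 2)) + 1); last by rewrite /eta; ring.
  by rewrite !powRD_gt0// powRr1 ?(ltW delta0)//; ring.
rewrite -[ltRHS](_ : 1 `^ q^-1 = 1); last by rewrite powR1.
apply: gt0_ltr_powR; rewrite ?invr_gt0 ?nnegrE ?mulr_ge0 ?powR_ge0//; first lra.
lra.
Qed.

End PointwiseInequality.

Theorem corollary1p2 (R : realType) (p beta : R)
    (hp : 1 < p) (hbeta : beta < p - 1) :
  exists q : R, [/\ 1 < q, q < p &
  exists C : R, 0 < C /\
    forall (Omega : set (R * R)), simply_connected_domain Omega ->
      Omega `<` [set: R * R] ->
    forall u : R * R -> R, test_function Omega u ->
    forall x : R * R, Omega x ->
    (`|u x|%:E <=
      (C * dist_boundary Omega x `^ (1 - beta / p))%:E *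
      ereal_sup [set (average (eucl_disk x r `&` Omega)
           (fun y => (eucl_norm (grad u y) `^ q *
                      dist_boundary Omega y `^ (q * beta / p))%:E))
           `^ q^-1 | r in [set r : R | 0 < r < 2 * dist_boundary Omega x]%R])%E].
Proof.
have p0 : 0 < p by lra.
have [q [q1 qp gq]] : exists q : R, [/\ 1 < q, q < p & q * beta / p < q - 1].
  have pb : 0 < p - beta by lra.
  have pb1 : p / (p - beta) < p by rewrite ltr_pdivrMr// ltr_pMr//; lra.
  (* [q * beta / p < q - 1] amounts to [p / (p - beta) < q] *)
  pose q := (Num.max 1 (p / (p - beta)) + p) / 2.
  have m1 : 1 <= Num.max 1 (p / (p - beta)) by rewrite le_max lexx.
  have m2 : p / (p - beta) <= Num.max 1 (p / (p - beta)) by rewrite le_max lexx orbT.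
  have m3 : Num.max 1 (p / (p - beta)) < p by rewrite gt_max hp pb1.
  exists q; split; [by rewrite /q; lra|by rewrite /q; lra|].
  have : p / (p - beta) < q by rewrite /q; lra.
  by rewrite ltr_pdivrMr// ltr_pdivrMr//; lra.
exists q; split => //.
pose gamma := q * beta / p.
have [m ratio1] := descent_ratio_lt1 q1 gq.
pose delta : R := 2^-1 ^+ (m + 5).
have delta0 : 0 < delta by rewrite exprn_gt0.
have d8 : delta <= 1 / 8.
  have -> : 1 / 8 = 2^-1 ^+ 3 :> R by field.
  by rewrite ler_wiXn2l ?invr_ge0 ?invf_le1// ?(leq_trans _ (leq_addl m 5))//; lra.
have N16 : (2 ^ m.+1)%:R * (16 * delta) <= 1.
  rewrite le_eqVlt; apply/orP; left; apply/eqP.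
  by rewrite /delta natrX exprVn exprD exprS; field; rewrite expf_neq0.
have [L L20] : exists L : nat, 20 <= L%:R * delta.
  exists (Num.truncn (20 / delta)).+1.
  by rewrite -ler_pdivrMr// ltW// truncnS_gt.
pose C := hardy_constant q gamma delta (m + 5) (2 ^ m.+1) L.
have C0 : 0 < C.
  rewrite /C /hardy_constant; apply: ltr_pwDl.
    by rewrite divr_gt0 ?ltr0n// /start_cost ltr_pwDl ?ltr0n// mulr_ge0 ?ler0n ?weight_bound_ge0.
  rewrite mulr_ge0// divr_ge0//; last by rewrite subr_ge0 ltW.
  by rewrite mulr_ge0// step_cost_ge0.
exists C; split => // Omega sc pO u tu x Ox.
have [[oO _ nO] _] := sc.
have rho0 : 0 < dist_boundary Omega x by exact: dist_boundary_gt0.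
have q0 : 0 < q by lra.
have ge : gamma / q = beta / p by rewrite /gamma; field; rewrite !gt_eqF.
set S := ereal_sup _.
have K0 : 0 < C * dist_boundary Omega x `^ (1 - beta / p) by rewrite mulr_gt0 ?powR_gt0.
have S_ge r : 0 < r < 2 * dist_boundary Omega x ->
    (average (eucl_disk x r `&` Omega) (fun y => (energy_density Omega u q gamma y)%:E)
      `^ q^-1 <= S)%E.
  by move=> r0; apply: ereal_sup_ubound; exists r.
have S0 : (0 <= S)%E.
  by apply: le_trans (S_ge (dist_boundary Omega x) _); [exact: poweR_ge0|lra].
move: S S0 S_ge => [s| |] // S0 S_ge; last first.
  by rewrite gt0_muley ?lte_fin// leey.
rewrite lee_fin in S0; rewrite -EFinM lee_fin.
apply/ler_addgt0Pr => e e0.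
(* [a] exceeds the supremum [s] so as to be positive even when [s] vanishes *)
pose a := s + e / (C * dist_boundary Omega x `^ (1 - beta / p)).
have sa : s < a by rewrite /a ltrDl divr_gt0.
have a0 : 0 < a by lra.
have disk r : 0 < r < 2 * dist_boundary Omega x ->
    (energy Omega u q gamma (eucl_disk x r `&` Omega) <= (a `^ q * (4 * r ^+ 2))%:E)%E.
  move=> r0; apply: energy_le_average => //; first by case/andP: r0.
  by apply: le_trans (S_ge r r0) _; rewrite lee_fin ltW.
have := hardy_of_disk_energy sc pO tu q1 (erefl delta) d8 (expn_gt0 2 m.+1)
  N16 L20 ratio1 Ox a0 disk.
move=> /le_trans; apply; rewrite ge -/C.
rewrite le_eqVlt; apply/orP; left; apply/eqP.
by rewrite /a; field; rewrite !gt_eqF ?powR_gt0.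
Qed.
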